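(* Let $X$ be a Banach space, let $A$ be an m-accretive operator in $X$, $u_0\in\overline{D(A)}$, $T>0$ and $g\in L^1(0,T;X)$. A function $u=u(t,\alpha)$ is an integral-process solution of $u'+Au\ni g$ on $[0,T]$, $u(0,\alpha)=u_0$, if and only if $u$ is independent of $\alpha$ and, for (almost) all $\alpha\in(0,1)$, $u(\cdot,\alpha)$ coincides with the unique integral and mild solution of $u'+Au\ni g$ on $[0,T]$, $u(0)=u_0$.
   Context: $\|\cdot\|$ is the norm of $X$. A (possibly multivalued) operator $A$ on $X$ is identified with its graph $A\subset X\times X$, with domain $D(A)$. $A$ is accretive if $\|x-\hat x\|\le\|x-\hat x+\lambda(y-\hat y)\|$ for all $(x,y),(\hat x,\hat y)\in A$, $\lambda>0$, and m-accretive if moreover $R(I+\lambda A)=X$ for all $\lambda>0$. The bracket is $[a,b]=\lim_{\lambda\downarrow0}\frac{\|a+\lambda b\|-\|a\|}{\lambda}$ for $a,b\in X$. Mild solution. For $\sigma>0$, a $\sigma$-discretization of $u'+Au\ni g$ on $[0,T]$ consists of $t_0<t_1<\dots<t_N$ with $t_0=0$, $t_i-t_{i-1}\le\sigma$, $0\le T-t_N\le\sigma$, and $g_1,\dots,g_N\in X$ with $\sum_{i}\int_{t_{i-1}}^{t_i}\|g(\tau)-g_i\|d\tau\le\sigma$; a $\sigma$-approximate solution of the initial-value problem is a piecewise constant function $v$ with $v(t_0)=v_0$, $v=v_i$ on $(t_{i-1},t_i]$, with $\frac{v_i-v_{i-1}}{t_i-t_{i-1}}+Av_i\ni g_i$ for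 $i=1,\dots,N$ and $\|v_0-u_0\|\le\sigma$. A mild solution is $u\in\mathcal C([0,T];X)$ such that for every $\sigma>0$ there is a $\sigma$-discretization having a $\sigma$-approximate solution $v$ with $\|u(t)-v(t)\|\le\sigma$ for $t_0\le t\le t_N$. Integral solution. $u\in\mathcal C([0,T];X)$ with $u(0)=u_0$ such that for all $(\hat u,z)\in A$ and $0\le s\le t\le T$, $\|u(t)-\hat u\|-\|u(s)-\hat u\|\le\int_s^t[u(\tau)-\hat u,g(\tau)-z]\,d\tau$. (It is known that for $A$ m-accretive and $u_0\in\overline{D(A)}$ there is a unique mild solution and it is the unique integral solution.) Integral-process solution. For $A$ accretive and $g\in L^1(0,T;X)$, a (measurable) function $v:(0,T]\times(0,1)\to X$ is an integral-process solution of $v'+Av\ni g$ on $[0,T]$, $v(0,\alpha)=\nu_0$, if for all $(\hat\nu,z)\in A$ and $0<s\le t\le T$, $$\int_0^1\big(\|v(t,\alpha)-\hat\nu\|-\|v(s,\alpha)-\hat\nu\|\big)d\alpha\le\int_0^1\!\int_s^t[v(\tau,\alpha)-\hat\nu,g(\tau)-z]\,d\tau d\alpha,$$ and $\operatorname{ess-lim}_{t\downarrow0}\int_0^1\|v(t,\alpha)-\nu_0\|d\alpha=0$. (The integrals are assumed to make sense; functions of $\alpha$ are identified when equal for a.e. $\alpha$, and solutions are compared for $t\in(0,T]$.) *)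

(* Defs.v *)
From HB Require Import structures.
From mathcomp Require Import all_boot all_order all_algebra.
From mathcomp Require Import all_classical all_reals all_analysis.
Set Implicit Arguments.
Unset Strict Implicit.
Unset Printing Implicit Defensive.
Import Order.TTheory GRing.Theory Num.Theory.
Import numFieldNormedType.Exports.
Local Open Scope classical_set_scope.
Local Open Scope ring_scope.

(** Measurability is up to null sets: the sigma-algebra of the domain (Borel
    sets for the real line) need not be complete, whereas functions are
    identified when they agree almost everywhere.  The library's integral of a
    nonnegative function is a supremum over the measurable simple functions
    below it, hence has the expected value for the norm of any function that is
    strongly measurable in this sense. *)

Definition simple_fun (d : measure_display) (S : measurableType d) (X : Type)
    (f : S -> X) : Prop :=
  finite_set (range f) /\ forall y : X, measurable (f @^-1` [set y]).

Definition strongly_measurable (R : realType) (d : measure_display)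
    (S : measurableType d) (X : normedModType R)
    (mu : {measure set S -> \bar R}) (D : set S) (f : S -> X) : Prop :=
  exists f_ : nat -> S -> X,
    (forall n, simple_fun (f_ n)) /\
    {ae mu, forall x, D x -> f_ ^~ x @ \oo --> f x}.

Definition bochner_L1 (R : realType) (d : measure_display)
    (S : measurableType d) (X : normedModType R)
    (mu : {measure set S -> \bar R}) (D : set S) (f : S -> X) : Prop :=
  strongly_measurable mu D f /\ (\int[mu]_(x in D) (`|f x|)%:E < +oo)%E.

Section Operators.
Context {R : realType} {X : normedModType R}.
Implicit Types A : set (X * X).

Definition op_domain A : set X := [set x | exists y, A (x, y)].

Definition accretive A : Prop :=
  forall x y x' y' : X, A (x, y) -> A (x', y') ->
  forall l : R, 0 < l -> `|x - x'| <= `|x - x' + l *: (y - y')|.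

Definition m_accretive A : Prop :=
  accretive A /\
  forall l : R, 0 < l -> [set p.1 + l *: p.2 | p in A] = [set: X].

Definition bracket (a b : X) : R :=
  lim ((fun l : R => (`|a + l *: b| - `|a|) / l) @ 0^'+).

End Operators.

(** Time-dependent functions are total on [R]; only their values on the
    relevant time interval are constrained. *)

Section Solutions.
Context {R : realType} {X : normedModType R}.
Variables (A : set (X * X)) (T : R) (g : R -> X).

Local Notation leb := (@lebesgue_measure R).

(** Only [t i] for [i <= N] and [gs i] for [1 <= i <= N] are relevant. *)
Definition discretization (sigma : R) (N : nat) (t : nat -> R)
    (gs : nat -> X) : Prop :=
  [/\ t 0%N = 0,
      (forall i, (i < N)%N -> t i < t i.+1 /\ t i.+1 - t i <= sigma),
      0 <= T - t N /\ T - t N <= sigma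
    & (\sum_(i < N) \int[leb]_(tau in `]t i, t i.+1])
         (`|g tau - gs i.+1|)%:E <= sigma%:E)%E ].

Definition approximate_solution (sigma : R) (u0 : X) (N : nat) (t : nat -> R)
    (gs : nat -> X) (v : R -> X) : Prop :=
  exists vs : nat -> X,
    [/\ v (t 0%N) = vs 0%N,
        (forall i, (i < N)%N ->
           forall tau, t i < tau -> tau <= t i.+1 -> v tau = vs i.+1),
        (forall i, (i < N)%N -> exists2 y, A (vs i.+1, y) &
           (t i.+1 - t i)^-1 *: (vs i.+1 - vs i) + y = gs i.+1)
      & `|vs 0%N - u0| <= sigma ].

Definition mild_solution (u0 : X) (u : R -> X) : Prop :=
  {within `[0, T], continuous u} /\
  forall sigma : R, 0 < sigma ->
    exists (N : nat) (t : nat -> R) (gs : nat -> X) (v : R -> X),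
      [/\ discretization sigma N t gs,
          approximate_solution sigma u0 N t gs v
        & forall tau, t 0%N <= tau -> tau <= t N -> `|u tau - v tau| <= sigma].

Definition integral_solution (u0 : X) (u : R -> X) : Prop :=
  [/\ {within `[0, T], continuous u},
      u 0 = u0
    & forall x z : X, A (x, z) -> forall s t : R, 0 <= s -> s <= t -> t <= T ->
      ((`|u t - x| - `|u s - x|)%:E <=
         \int[leb]_(tau in `]s, t]) (bracket (u tau - x) (g tau - z))%:E)%E ].

Definition unique_integral_mild_solution (u0 : X) (u : R -> X) : Prop :=
  [/\ mild_solution u0 u,
      integral_solution u0 u
    & forall w : R -> X, mild_solution u0 w \/ integral_solution u0 w ->
        forall t, 0 <= t -> t <= T -> w t = u t ].

Definition process_measurable (v : R -> R -> X) : Prop :=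
  strongly_measurable (leb \x leb)%E (`]0, T] `*` `]0, 1[)
    (fun p : R * R => v p.1 p.2).

Definition ess_lim_at0 (f : R -> \bar R) (l : R) : Prop :=
  forall e : R, 0 < e -> exists2 delta : R, 0 < delta &
    {ae leb, forall t, 0 < t -> t < delta -> (`|f t - l%:E| < e%:E)%E}.

(** Integrability of the left-hand integrand is part of the definition.  On the
    right-hand side it comes for free when [v] is measurable and [g] is
    integrable, because [|bracket a b| <= `|b|]. *)
Definition integral_process_solution (nu0 : X) (v : R -> R -> X) : Prop :=
  [/\ process_measurable v,
      (forall x z : X, A (x, z) -> forall s t : R, 0 < s -> s <= t -> t <= T ->
         @bochner_L1 R _ _ R^o leb `]0, 1[
           (fun alpha => `|v t alpha - x| - `|v s alpha - x|) /\
         (\int[leb]_(alpha in `]0%R, 1%R[)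
              (`|v t alpha - x| - `|v s alpha - x|)%:E <=
            \int[leb]_(alpha in `]0%R, 1%R[) \int[leb]_(tau in `]s, t])
              (bracket (v tau alpha - x) (g tau - z))%:E)%E)
    & ess_lim_at0
        (fun t => \int[leb]_(alpha in `]0%R, 1%R[) (`|v t alpha - nu0|)%:E)%E 0 ].

(** Functions of [alpha] are identified when equal for a.e. [alpha], at each
    time [t]: the exceptional null set may depend on [t], as nothing in the
    definition of an integral-process solution controls it uniformly. *)
Definition process_coincides (v : R -> R -> X) (w : R -> X) : Prop :=
  forall t, 0 < t -> t <= T ->
    {ae leb, forall alpha, 0 < alpha -> alpha < 1 -> v t alpha = w t}.

Definition independent_of_alpha (v : R -> R -> X) : Prop :=
  exists w : R -> X, process_coincides v w.

End Solutions.

(* Main.v *)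
Require Import Defs.
From HB Require Import structures.
From mathcomp Require Import all_boot all_order all_algebra.
From mathcomp Require Import all_classical all_reals all_analysis.
From mathcomp Require Import measurable_realfun ring lra.
Set Implicit Arguments.
Unset Strict Implicit.
Unset Printing Implicit Defensive.
Import Order.TTheory GRing.Theory Num.Theory.
Import numFieldNormedType.Exports.
Local Open Scope classical_set_scope.
Local Open Scope ring_scope.

(** An m-accretive operator makes implicit Euler schemes solvable, and everything
    rests on comparing such schemes with other objects.

    Existence.  For a continuous forcing [h] and a starting point [x] in the
    domain of [A], two Euler schemes of steps [l] and [m] satisfy a discrete
    inequality in the two indices, for which a quadratic expression in the time
    difference is an exact solution ([euler_compare]).  So the schemes converge
    uniformly as the step tends to [0].  Schemes with the same step depend on
    [(x, h)] in a nonexpansive way, up to the mean distance of the forcings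
    ([euler_stable]); as continuous functions are dense in [L^1] and [u0] is in
    the closure of the domain, a diagonal choice of schemes converges to a mild
    solution for the given data ([euler_limit]).

    Uniqueness.  For an integral solution [w] put [phi t x = `|w t - x|]; for an
    integral-process solution [v] let [phi t x] be the mean of
    [`|v t alpha - x|] over [alpha].  If [x'], [x] are consecutive values of an
    Euler scheme of step [l] with forcing [c], testing the definition with [x]
    and bounding the bracket by a difference quotient gives, in integrated form,
    [phi' x <= `|g - c| + (phi x' - phi x) / l].  A function [phi] with this
    property is called a distance profile.  The inequality is the continuous
    counterpart, in one of the two indices, of the discrete one above, and the
    same quadratic expression is a supersolution ([profile_euler_le]).  Hence,
    along the converging schemes, [phi T x] tends to [0] as [x] tends to a point
    that does not depend on [phi] ([profile_endpoint]).  For an integral solution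
    this determines [w T].  For a process it says that [v T alpha] equals that
    same point for almost every [alpha]: a solution cannot spread over
    [alpha].  Any time [t] in [(0, T]] may be taken as the final time.

    Mild solutions are integral solutions because accretivity gives the
    corresponding inequality at each step of an approximate solution
    ([accretive_dquot], [mild_dquot_le]).  Conversely a process that coincides
    with the integral solution satisfies the definition of an integral-process
    solution by Tonelli's theorem, which exchanges the null sets of [alpha] and
    of the time.

    The given functions are measurable only up to null sets, so [g] and the
    process are first replaced by everywhere defined limits of simple functions;
    the integrals do not notice ([integral_ae_eq]). *)

(** * Linear identities *)

(** Formal linear combinations of vectors, reified by [lincomb] below: a linear
    identity in a module holds as soon as it holds for the scalar coefficients
    of each atom, where [ring] and [field] apply. *)
Section LinearCombinations.
Context {R : pzRingType} {V : lmodType R}.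

Inductive lexp : Type :=
  LAtom of nat | LZero | LAdd of lexp & lexp | LOpp of lexp | LScale of R & lexp.

Fixpoint leval (v : seq V) e : V := match e with
  | LAtom i => nth 0 v i
  | LZero => 0
  | LAdd e1 e2 => leval v e1 + leval v e2
  | LOpp e1 => - leval v e1
  | LScale c e1 => c *: leval v e1
  end.

Fixpoint lcoef e (i : nat) : R := match e with
  | LAtom j => if (i == j)%N then 1 else 0
  | LZero => 0
  | LAdd e1 e2 => lcoef e1 i + lcoef e2 i
  | LOpp e1 => - lcoef e1 i
  | LScale c e1 => c * lcoef e1 i
  end.

Lemma levalE v e : leval v e = \sum_(i < size v) lcoef e i *: v`_i.
Proof.
elim: e => [j||e1 IH1 e2 IH2|e1 IH1|c e1 IH1] /=.
- case: (ltnP j (size v)) => [jv|vj].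
    rewrite (bigD1 (Ordinal jv))//= eqxx scale1r big1 ?addr0// => i.
    by rewrite -val_eqE /= => /negbTE ->; rewrite scale0r.
  rewrite nth_default// big1// => i _; case: eqP => [ij|_]; rewrite ?scale0r//.
  by move: (ltn_ord i); rewrite ij ltnNge vj.
- by rewrite big1// => i _; rewrite scale0r.
- by rewrite IH1 IH2 -big_split; apply: eq_bigr => i _; rewrite scalerDl.
- by rewrite IH1 -sumrN; apply: eq_bigr => i _; rewrite scaleNr.
- by rewrite IH1 scaler_sumr; apply: eq_bigr => i _; rewrite scalerA.
Qed.

Fixpoint same_coef e1 e2 n : Prop :=
  if n is n'.+1 then lcoef e1 n' = lcoef e2 n' /\ same_coef e1 e2 n' else True.

Lemma leval_eq v e1 e2 : same_coef e1 e2 (size v) -> leval v e1 = leval v e2.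
Proof.
rewrite !levalE => H; apply: eq_bigr => -[i /= iv] _; congr (_ *: _).
by elim: (size v) iv H => // n IH; rewrite ltnS leq_eqVlt => /predU1P[->|/IH{}IH] [].
Qed.

End LinearCombinations.

Ltac lindex v t k := lazymatch v with
  | cons t _ => constr:(k)
  | cons _ ?v' => lindex v' t (S k)
  end.

Ltac lreify R V v t := lazymatch t with
  | (?a + ?b) => let a' := lreify R V v a in let b' := lreify R V v b in
     constr:(@LAdd R a' b')
  | (- ?a) => let a' := lreify R V v a in constr:(@LOpp R a')
  | (?c *: ?a) => let a' := lreify R V v a in constr:(@LScale R c a')
  | (0) => constr:(@LZero R)
  | ?t => let i := lindex v t O in constr:(@LAtom R i)
  end.

(** [lincomb R [:: x; y]] reduces an equality between linear combinations of
    [x] and [y] over [R] to the equality of their coefficients. *)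
Ltac lincomb R v := lazymatch goal with
  | |- @eq ?V ?s ?t => let s' := lreify R V v s in let t' := lreify R V v t in
     apply: (@leval_eq R _ v s' t'); repeat split; cbn [lcoef eqn size]
  end.

(** * The bracket *)

Section Bracket.
Context {R : realType} {X : normedModType R}.
Implicit Types (a b c : X) (l m : R).

Definition dquot a b l : R := (`|a + l *: b| - `|a|) / l.

Lemma dquot_mono a b l m : 0 < l -> l <= m -> dquot a b l <= dquot a b m.
Proof.
move=> l0 lm; have m0 : 0 < m by lra.
have E : m *: (a + l *: b) = (m - l) *: a + l *: (a + m *: b).
  by lincomb R [:: a; b]; ring.
have H : m * `|a + l *: b| <= (m - l) * `|a| + l * `|a + m *: b|.
  have := ler_normD ((m - l) *: a) (l *: (a + m *: b)).
  by rewrite -E !normrZ (gtr0_norm l0) (gtr0_norm m0) ger0_norm ?subr_ge0.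
by rewrite /dquot ler_pdivlMr// mulrAC ler_pdivrMr//; lra.
Qed.

Lemma ler_norm_dquot a b l : 0 < l -> `|dquot a b l| <= `|b|.
Proof.
move=> l0; rewrite /dquot normrM normfV (gtr0_norm l0) ler_pdivrMr//.
rewrite (le_trans (ler_dist_dist _ _))// addrAC subrr add0r normrZ.
by rewrite (gtr0_norm l0) mulrC.
Qed.

Lemma ler_dquotD a b c l : 0 < l -> dquot a (b + c) l <= `|b| + dquot a c l.
Proof.
move=> l0; rewrite /dquot -[`|b|](mulfK (lt0r_neq0 l0)) -mulrDl.
rewrite ler_pM2r ?invr_gt0// addrA lerD2r.
have -> : a + l *: (b + c) = l *: b + (a + l *: c) by lincomb R [:: a; b; c]; ring.
by rewrite (le_trans (ler_normD _ _))// normrZ (gtr0_norm l0) mulrC.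
Qed.

Lemma ler_dquotB a a' b b' l : 0 < l ->
  dquot a b l <= dquot a' b' l + 2 * `|a - a'| / l + `|b - b'|.
Proof.
move=> l0; rewrite /dquot -[`|b - b'|](mulfK (lt0r_neq0 l0)) -!mulrDl.
rewrite ler_pM2r ?invr_gt0//.
have -> : a + l *: b = (a' + l *: b') + ((a - a') + l *: (b - b')).
  by lincomb R [:: a; b; a'; b']; ring.
have := ler_normD (a' + l *: b') ((a - a') + l *: (b - b')).
have := ler_normD (a - a') (l *: (b - b')).
have := lerB_dist a' a; rewrite distrC.
rewrite normrZ (gtr0_norm l0); lra.
Qed.

Lemma dquot_cvg a b : dquot a b l @[l --> 0^'+] --> bracket a b.
Proof.
suff : cvg (dquot a b l @[l --> 0^'+]) by [].
apply: cvgP (@nondecreasing_at_right_cvgr _ (dquot a b) 0 +oo%O _ _ _) => //.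
- by move=> l m; rewrite !in_itv /= !andbT => l0 _ lm; exact: dquot_mono.
- exists (- `|b|) => y [l]; rewrite /= in_itv/= andbT => l0 <-.
  by have := ler_norm_dquot a b l0; rewrite ler_norml => /andP[].
Qed.

(** Difference quotients of the convex function [l |-> `|a + l *: b|] decrease
    with the increment, so the bracket is their infimum: an inequality between
    brackets can be read off at any one increment. *)
Lemma bracket_le_dquot a b l : 0 < l -> bracket a b <= dquot a b l.
Proof.
move=> l0; apply: cvgr_to_le (@dquot_cvg a b) _.
near=> m; apply: dquot_mono; first by near: m; exact: nbhs_right_gt.
by near: m; exact: nbhs_right_le.
Unshelve. all: by end_near. Qed.

Lemma ler_norm_bracket a b : `|bracket a b| <= `|b|.
Proof.
rewrite ler_norml; apply/andP; split.
  apply: cvgr_to_ge (@dquot_cvg a b) _; near=> m.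
  have m0 : 0 < m by near: m; exact: nbhs_right_gt.
  by have := ler_norm_dquot a b m0; rewrite ler_norml => /andP[].
apply: le_trans (bracket_le_dquot a b ltr01) _.
by have := ler_norm_dquot a b ltr01; rewrite ler_norml => /andP[].
Unshelve. all: by end_near. Qed.

Lemma dquot_harmonic_cvg a b :
  dquot a b n.+1%:R^-1 @[n --> \oo] --> bracket a b.
Proof.
have /cvg_at_rightP := @dquot_cvg a b; apply; split=> [n|].
  by rewrite invr_gt0.
exact: cvg_harmonic.
Qed.

(** The step [a + l *: (a' - a) / l = a'] turns the bracket along [a' - a] into
    a difference of norms. *)
Lemma bracket_le_norm a a' c l : 0 < l ->
  bracket a (c + l^-1 *: (a' - a)) <= `|c| + (`|a'| - `|a|) / l.
Proof.
move=> l0; apply: le_trans (bracket_le_dquot _ _ l0) _.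
apply: le_trans (ler_dquotD _ _ _ l0) _; rewrite /dquot scalerA mulfV ?gt_eqF//.
by rewrite scale1r addrCA subrr addr0.
Qed.

End Bracket.

(** * Resolvents and the implicit Euler scheme *)

Section Euler.
Context {R : realType} {X : normedModType R}.
Variable A : set (X * X).
Implicit Types (x y z p q : X) (l m : R) (h : R -> X).

Definition resolvent l z : X :=
  xget 0 [set x | exists2 y, A (x, y) & x + l *: y = z].

Lemma resolventP l z : m_accretive A -> 0 < l ->
  A (resolvent l z, l^-1 *: (z - resolvent l z)).
Proof.
move=> [_ mA] l0; rewrite /resolvent.
case: xgetP => [x _ [y Axy <-]|].
  by rewrite [x + _]addrC addrK scalerA mulVf ?gt_eqF// scale1r.
move=> nx; exfalso; have : [set: X] z by [].
rewrite -(mA _ l0) => -[[x y] /= Axy xyz]; apply: (nx x); by exists y.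
Qed.

(** The forcing is sampled at the right end of each step, as the implicit scheme
    evaluates the operator there. *)
Fixpoint euler l h x (n : nat) : X :=
  if n is n'.+1 then resolvent l (euler l h x n' + l *: h (n'.+1%:R * l)) else x.

Lemma eulerS l h x n :
  euler l h x n.+1 = resolvent l (euler l h x n + l *: h (n.+1%:R * l)).
Proof. by []. Qed.

Hypothesis mA : m_accretive A.

Lemma euler_graph l h x n : 0 < l ->
  A (euler l h x n.+1,
     h (n.+1%:R * l) - l^-1 *: (euler l h x n.+1 - euler l h x n)).
Proof.
move=> l0; have := resolventP (euler l h x n + l *: h (n.+1%:R * l)) mA l0.
rewrite -eulerS; congr (A (_, _)).
by lincomb R [:: euler l h x n; euler l h x n.+1; h (n.+1%:R * l)]; field;
   rewrite gt_eqF.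
Qed.

Lemma euler_domain l h x n : 0 < l -> op_domain A x ->
  op_domain A (euler l h x n).
Proof.
case: n => [//|n] l0 _; eexists; exact: euler_graph.
Qed.

(** Accretivity with the parameter [l * m / (l + m)] replaces one of the two
    points at a time by its predecessor, with convex weights. *)
Lemma accretive_two_steps p p0 q q0 f k l m : 0 < l -> 0 < m ->
  A (p, f - l^-1 *: (p - p0)) -> A (q, k - m^-1 *: (q - q0)) ->
  (l + m) * `|p - q| <= l * `|p - q0| + m * `|p0 - q| + l * m * `|f - k|.
Proof.
move=> l0 m0 Ap Aq; have lm0 : 0 < l + m by lra.
have t0 : 0 < l * m / (l + m) by rewrite divr_gt0// mulr_gt0.
have := mA.1 _ _ _ _ Ap Aq _ t0; set t := l * m / (l + m) => H.
have -> : l * `|p - q0| + m * `|p0 - q| + l * m * `|f - k| =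
   `|l *: (p - q0)| + `|m *: (p0 - q)| + `|(l * m) *: (f - k)|.
  by rewrite !normrZ !gtr0_norm ?mulr_gt0.
rewrite mulrC -ler_pdivlMr//.
apply: le_trans H _; rewrite ler_pdivlMr// mulrC -[X in X * _](gtr0_norm lm0).
rewrite -normrZ; set a := (X in `|X| <= _).
suff -> : a = l *: (p - q0) + m *: (p0 - q) + (l * m) *: (f - k).
  by rewrite (le_trans (ler_normD _ _))// lerD2r ler_normD.
rewrite {}/a /t.
by lincomb R [:: p; p0; q; q0; f; k]; field; rewrite ?gt_eqF.
Qed.

End Euler.

(** * Estimates for Euler schemes *)

Section EulerEstimates.
Context {R : realType} {X : normedModType R}.
Variable A : set (X * X).
Hypothesis mA : m_accretive A.
Implicit Types (x y z p q : X) (l m s r d eta : R) (h : R -> X).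

(** The quadratic majorant [(eta + (d ^+ 2 + b) / eta) / 2] of
    [Num.sqrt (d ^+ 2 + b)]; being affine in [d ^+ 2 + b], it solves the
    discrete and differential inequalities below exactly. *)
Definition qbound eta d b : R := (eta + (d ^+ 2 + b) / eta) / 2.

Lemma qbound_ge eta d b : 0 < eta -> 0 <= b -> `|d| <= qbound eta d b.
Proof.
move=> e0 b0; have -> : qbound eta d b = (eta ^+ 2 + d ^+ 2 + b) / (2 * eta).
  by rewrite /qbound; field; rewrite gt_eqF.
rewrite ler_pdivlMr ?mulr_gt0//; rewrite -(real_normK (num_real d)).
by have := sqr_ge0 (`|d| - eta); nra.
Qed.

Context (T : R) (h : R -> X) (L e M : R) (x y : X).
Hypothesis L0 : 0 <= L.
Hypothesis e0 : 0 <= e.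
Hypothesis hL : forall s t, 0 <= s <= T -> 0 <= t <= T ->
  `|h s - h t| <= e + L * `|s - t|.
Hypothesis Axy : A (x, y).
Hypothesis hM : forall s, 0 <= s <= T -> `|h s - y| <= M.

Lemma euler_near_start l n : 0 < l -> n%:R * l <= T ->
  `|euler A l h x n - x| <= M * (n%:R * l).
Proof.
move=> l0; elim: n => [|n IH] nT; first by rewrite subrr normr0 !mul0r mulr0.
have nS : n.+1%:R * l = n%:R * l + l :> R by rewrite -natr1 mulrDl mul1r.
have n0 : 0 <= n%:R * l by rewrite mulr_ge0// ltW.
have {}IH := IH (le_trans _ nT); have {IH} : `|euler A l h x n - x| <= M * (n%:R * l).
  by apply: IH; rewrite nS; lra.
have hn : `|h (n.+1%:R * l) - y| <= M by apply: hM; rewrite nT nS; lra.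
have := mA.1 _ _ _ _ (euler_graph mA h x n l0) Axy _ l0.
set p := euler A l h x n.+1; set p0 := euler A l h x n; set f := h _ in hn *.
have -> : p - x + l *: (f - l^-1 *: (p - p0) - y) = (p0 - x) + l *: (f - y).
  by lincomb R [:: p; p0; x; y; f]; field; rewrite gt_eqF.
move=> H; have := ler_normD (p0 - x) (l *: (f - y)).
by rewrite normrZ gtr0_norm// nS; nra.
Qed.

(** Two Euler schemes of steps [l] and [m] satisfy the discrete inequality of
    [accretive_two_steps], whose first two weights average [qbound] exactly
    when its last argument grows at rates [l] and [m]; the factor [M + L * s]
    absorbs the variation of the forcing. *)
Lemma euler_compare eta l m i j : 0 < eta -> 0 < l -> 0 < m ->
  i%:R * l <= T -> j%:R * m <= T ->
  `|euler A l h x i - euler A m h x j| <=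
    (M + L * (i%:R * l)) * qbound eta (i%:R * l - j%:R * m)
                                  (i%:R * l * l + j%:R * m * m)
    + (L * l + e) * (i%:R * l).
Proof.
move=> eta0 l0 m0; move: i j.
have M0 : 0 <= T -> 0 <= M.
  by move=> T0; apply: le_trans (hM (s := 0) _) => //; rewrite lexx.
have nS n k : n.+1%:R * k = n%:R * k + k :> R by rewrite -natr1 mulrDl mul1r.
have n0 n k : 0 < k -> 0 <= n%:R * k :> R by move=> k0; rewrite mulr_ge0// ltW.
elim=> [|i IHi].
  move=> j _ jT; have jm := n0 j _ m0.
  rewrite distrC !mul0r !mulr0 !addr0 sub0r add0r.
  apply: le_trans (euler_near_start m0 jT) _; rewrite ler_wpM2l ?M0//; first lra.
  apply: le_trans (ler_norm _) _; rewrite -normrN qbound_ge//.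
  by rewrite mulr_ge0// ltW.
elim=> [|j IHj] iT jT.
  have il := n0 i.+1 _ l0; have := M0 (le_trans il iT) => {}M0.
  apply: le_trans (euler_near_start l0 iT) _.
  rewrite !mul0r subr0 addr0 -[leLHS]addr0 lerD//; last first.
    by rewrite mulr_ge0// addr_ge0// mulr_ge0// ltW.
  have b0 : 0 <= i.+1%:R * l * l by rewrite mulr_ge0// ltW.
  have := qbound_ge (i.+1%:R * l) eta0 b0; rewrite (ger0_norm il).
  set q := qbound _ _ _; set s := _ * l in il *; have := mulr_ge0 L0 il; nra.
have il := n0 i _ l0; have jm := n0 j _ m0.
have iT' : i%:R * l <= T by rewrite nS in iT; lra.
have jT' : j%:R * m <= T by rewrite nS in jT; lra.
have {M0} M0 := M0 (le_trans il iT').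
have {IHi} := IHi j.+1 iT' jT; have {IHj} := IHj iT jT'.
have := accretive_two_steps mA l0 m0 (euler_graph mA h x i l0)
  (euler_graph mA h x j m0).
have := hL (s := i.+1%:R * l) (t := j.+1%:R * m).
have hl : 0 <= i.+1%:R * l <= T by rewrite iT n0.
have hm : 0 <= j.+1%:R * m <= T by rewrite jT n0.
move=> /(_ hl hm) {hl hm}.
set f := h (i.+1%:R * l); set k := h (j.+1%:R * m); rewrite !nS {iT jT}.
move: (i%:R * l) (j%:R * m) il jm {iT' jT'} => s r s0 r0.
have := qbound_ge (s - (r + m)) eta0 (b := s * l + (r + m) * m).
have b0 : 0 <= s * l + (r + m) * m by rewrite addr_ge0 ?mulr_ge0//; lra.
move=> /(_ b0) {b0}.
have : (l + m) * qbound eta (s + l - (r + m)) ((s + l) * l + (r + m) * m) =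
  l * qbound eta (s + l - r) ((s + l) * l + r * m) +
  m * qbound eta (s - (r + m)) (s * l + (r + m) * m).
  by rewrite /qbound; field; rewrite gt_eqF.
set q := qbound eta (s + l - (r + m)) _; set q1 := qbound eta (s + l - r) _.
set q2 := qbound eta (s - (r + m)) _ => qE dq2.
have : `|s + l - (r + m)| <= `|s - (r + m)| + l.
  have -> : s + l - (r + m) = s - (r + m) + l by ring.
  by rewrite (le_trans (ler_normD _ _))// lerD2l gtr0_norm.
set d := `|s - (r + m)| in dq2 *; set d' := `|s + l - (r + m)| => dd' Hfk.
set fk := `|f - k| in Hfk *; set a := `|euler _ _ _ _ i.+1 - euler _ _ _ _ j.+1|.
set b := `|euler _ _ _ _ i.+1 - euler _ _ _ _ j|.
set c := `|euler _ _ _ _ i - euler _ _ _ _ j.+1| => Ha Hb Hc.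
have lm : 0 < l * m by rewrite mulr_gt0.
rewrite -(ler_pM2l (x := l + m)); last lra.
have -> : (l + m) * ((M + L * (s + l)) * q + (L * l + e) * (s + l)) =
  (M + L * (s + l)) * (l * q1 + m * q2) + (l + m) * ((L * l + e) * (s + l)).
  by rewrite -qE; ring.
have H1 : l * m * fk <= l * m * (e + L * (q2 + l)).
  rewrite ler_pM2l//; apply: le_trans Hfk _; rewrite lerD2l ler_wpM2l//; lra.
have H2 : l * b <= l * ((M + L * (s + l)) * q1 + (L * l + e) * (s + l)).
  by rewrite ler_pM2l.
have H3 : m * c <= m * ((M + L * s) * q2 + (L * l + e) * s).
  by rewrite ler_pM2l.
lra.
Qed.

End EulerEstimates.

Section EulerStability.
Context {R : realType} {X : normedModType R}.
Variable A : set (X * X).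
Hypothesis mA : m_accretive A.

Lemma euler_stable (l : R) (h k : R -> X) (x z : X) n : 0 < l ->
  `|euler A l h x n - euler A l k z n| <= `|x - z| +
    \sum_(i < n) l * `|h (i.+1%:R * l) - k (i.+1%:R * l)|.
Proof.
move=> l0; elim: n => [|n IH]; first by rewrite big_ord0 addr0.
rewrite big_ord_recr /= -/(euler _ _ _ _ n.+1) addrA.
have := mA.1 _ _ _ _ (euler_graph mA h x n l0) (euler_graph mA k z n l0) _ l0.
set p := euler A l h x n.+1; set p0 := euler A l h x n in IH *.
set q := euler A l k z n.+1; set q0 := euler A l k z n in IH *.
set f := h (n.+1%:R * l); set g := k (n.+1%:R * l).
have -> : p - q + l *: (f - l^-1 *: (p - p0) - (g - l^-1 *: (q - q0))) =
    (p0 - q0) + l *: (f - g).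
  by lincomb R [:: p; q; p0; q0; f; g]; field; rewrite gt_eqF.
move=> H; apply: le_trans H _; apply: le_trans (ler_normD _ _) _.
by rewrite lerD// normrZ gtr0_norm.
Qed.

End EulerStability.

(** * Integrals and measurability up to null sets *)

Section AlmostEverywhere.
Context {d : measure_display} {S : measurableType d} {R : realType}.
Variable mu : {measure set S -> \bar R}.
Implicit Types P Q K : S -> Prop.

Lemma ae_mono P Q : (forall x, P x -> Q x) ->
  {ae mu, forall x, P x} -> {ae mu, forall x, Q x}.
Proof. by move=> PQ; apply: filterS. Qed.

Lemma ae_mono2 P Q K : (forall x, P x -> Q x -> K x) ->
  {ae mu, forall x, P x} -> {ae mu, forall x, Q x} -> {ae mu, forall x, K x}.
Proof. by move=> PQK; apply: filterS2. Qed.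

End AlmostEverywhere.

Section IntegralUpToNull.
Context {d : measure_display} {S : measurableType d} {R : realType}.
Variable mu : {measure set S -> \bar R}.
Import HBNNSimple.

(** The integral of a nonnegative function is the supremum of the integrals of
    the simple functions below it, and multiplying a simple function by the
    indicator of a conull set does not change its integral.  So integrals
    compare almost everywhere, measurable or not. *)
Lemma ge0_le_integral_ae (D : set S) (f f' : S -> \bar R) :
  (forall x, D x -> 0 <= f x)%E -> (forall x, D x -> 0 <= f' x)%E ->
  {ae mu, forall x, D x -> (f x <= f' x)%E} ->
  (\int[mu]_(x in D) f x <= \int[mu]_(x in D) f' x)%E.
Proof.
move=> f0 f'0 [N [mN N0 subN]]; rewrite !ge0_integralE//.
have mNC : measurable (~` N) by exact: measurableC.
apply: ge_ereal_sup => _ [h hf <-].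
have <- : sintegral mu (proj_nnsfun h mNC) = sintegral mu h.
  rewrite -!integralT_nnsfun; apply: ae_eq_integral => //.
  - exact/measurable_EFinP.
  - exact/measurable_EFinP.
  exists N; split => // x /=; apply: contra_notP => Nx _.
  by rewrite mindicE mem_set// mulr1.
apply: ereal_sup_ubound; exists (proj_nnsfun h mNC) => // x /=.
rewrite mindicE; have [xN|xN] := boolP (x \in ~` N); last first.
  rewrite mulr0; rewrite /patch; case: ifPn => // /set_mem Dx; exact: f'0.
rewrite mulr1 (le_trans (hf x))// /patch; case: ifPn => // /set_mem Dx.
by apply: contrapT => H; move/set_mem: xN; apply; apply: subN => /(_ Dx).
Qed.

Lemma le_integral_ae (D : set S) (f f' : S -> \bar R) :
  {ae mu, forall x, D x -> (f x <= f' x)%E} ->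
  (\int[mu]_(x in D) f x <= \int[mu]_(x in D) f' x)%E.
Proof.
move=> ff'; rewrite integralE [leRHS]integralE; apply: leeB;
  apply: ge0_le_integral_ae => //; apply: ae_mono ff' => x /[apply] ff'.
  by rewrite !funeposE le_max2.
by rewrite !funenegE le_max2// leeN2.
Qed.

Lemma integral_ae_eq (D : set S) (f f' : S -> \bar R) :
  {ae mu, forall x, D x -> f x = f' x} ->
  (\int[mu]_(x in D) f x = \int[mu]_(x in D) f' x)%E.
Proof.
move=> ff'; apply/eqP; rewrite eq_le; apply/andP; split; apply: le_integral_ae;
  by apply: ae_mono ff' => x /[apply] ->.
Qed.

End IntegralUpToNull.

Section StrongMeasurability.
Context {d : measure_display} {S : measurableType d} {R : realType}
  {X : normedModType R}.
Implicit Types (f : S -> X) (D : set S).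

Definition limit_simple f : Prop :=
  exists2 f_ : nat -> S -> X, forall n, simple_fun (f_ n) &
    forall x, f_ ^~ x @ \oo --> f x.

Lemma simple_fun_patch f D : measurable D -> simple_fun f ->
  simple_fun (fun x => if x \in D then f x else 0).
Proof.
move=> mD [finf mf]; split.
  apply: (@sub_finite_set _ _ (range f `|` [set 0])); last first.
    by rewrite finite_setU; split => //; exact: finite_set1.
  by move=> _ [x _ <-]; case: ifPn => _; [left; exists x|right].
move=> y; rewrite (_ : _ @^-1` _ =
  (D `&` f @^-1` [set y]) `|` (~` D `&` (if 0 == y then setT else set0))).
  apply: measurableU; first exact: measurableI.
  by apply: measurableI; [exact: measurableC|case: ifP].
apply/seteqP; split => x /=.
  case: ifPn => [/set_mem Dx <-|]; first by left.
  move=> /negP xD <-; right; rewrite eqxx; split => //.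
  by move=> Dx; apply: xD; rewrite mem_set.
case=> [[Dx <-]|[Dx]]; first by rewrite mem_set.
rewrite memNset//; by case: eqP.
Qed.

(** Redefining a function to be [0] off a conull part of its domain turns almost
    everywhere limits of simple functions into pointwise ones. *)
Lemma strongly_measurable_representative (mu : {measure set S -> \bar R}) D f :
  measurable D -> strongly_measurable mu D f ->
  exists f', [/\ limit_simple f', (forall x, ~ D x -> f' x = 0) &
    {ae mu, forall x, D x -> f x = f' x}].
Proof.
move=> mD [f_ [sf [N [mN N0 subN]]]].
pose E := D `\` N; have mE : measurable E by exact: measurableD.
exists (fun x => if x \in E then f x else 0); split.
- exists (fun n x => if x \in E then f_ n x else 0).
    by move=> n; exact: simple_fun_patch.
  move=> x; case: ifPn => [/set_mem [Dx Nx]|_]; last exact: cvg_cst.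
  by apply: contrapT => H; apply: Nx; apply: subN => /(_ Dx).
- by move=> x Dx; rewrite memNset// => -[].
- exists N; split=> // x /=; apply: contra_notP => Nx Dx.
  by rewrite mem_set.
Qed.

(** For a simple function the second argument is constant on each of finitely
    many measurable pieces; continuity in that argument does the rest. *)
Lemma measurable_fun_caratheodory D f (F : S -> X -> R) : measurable D ->
  limit_simple f -> (forall y, measurable_fun D (F ^~ y)) ->
  (forall x, D x -> continuous (F x)) -> measurable_fun D (fun x => F x (f x)).
Proof.
move=> mD [f_ sf f_f] mF cF.
apply: (@measurable_fun_cvg _ _ _ _ (fun n x => F x (f_ n x))); last first.
  by move=> x Dx; apply: continuous_cvg (f_f x); exact: cF.
move=> n _ Y mY; have [finf mf] := sf n.
rewrite (_ : _ `&` _ = \bigcup_(y in range (f_ n))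
    (f_ n @^-1` [set y] `&` (D `&` (F ^~ y) @^-1` Y))); last first.
  apply/seteqP; split => [x [Dx /= Yx]|x [y _ /= [-> [Dx Yx]]]]//.
  by exists (f_ n x); [exists x|].
apply: fin_bigcup_measurable => // y _; apply: measurableI => //.
exact: mF.
Qed.

Lemma measurable_fun_limit_simple f (F : X -> R) : limit_simple f ->
  continuous F -> measurable_fun setT (F \o f).
Proof.
move=> sf cF; apply: (measurable_fun_caratheodory (F := fun=> F)) => //.
Qed.

End StrongMeasurability.

(** * Integrals over half-open intervals *)

Section WithinContinuity.
Context {R : realType} {X : normedModType R}.

Lemma within_continuous_itvP (f : R -> X) (a b : R) :
  {within `[a, b], continuous f} <->
  (forall r, a <= r <= b -> forall e, 0 < e -> exists2 d, 0 < d &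
    forall s, a <= s <= b -> `|s - r| <= d -> `|f s - f r| <= e).
Proof.
split=> [/subspace_continuousP cf r rab e e0|H].
  have /(_ _) := cf r; rewrite /= in_itv/= => /(_ rab)/cvgrPdist_le/(_ _ e0).
  rewrite near_withinE => /nbhs_ballP[d /= d0 dH]; exists (d / 2); first lra.
  move=> s sab sr; rewrite distrC; apply: dH; last by rewrite /= in_itv.
  rewrite /ball /= distrC; lra.
apply/subspace_continuousP => r; rewrite /= in_itv/= => rab.
apply/cvgrPdist_le => e e0; rewrite near_withinE.
have [d d0 dH] := H r rab e e0; apply/nbhs_ballP; exists d => //= s.
rewrite /ball /= in_itv/= distrC => sr sab; rewrite distrC dH// ltW//.
Qed.

End WithinContinuity.

Section HalfOpenIntegrals.
Context {R : realType}.
Local Notation leb := (@lebesgue_measure R).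
Implicit Types (f F : R -> R) (a b s t r c : R).

Definition ioc_integrable a b f : Prop := leb.-integrable `]a, b] (EFin \o f).
Definition ioc_int f s t : R := \int[leb]_(x in `]s, t]) f x.

Lemma ioc_integrableS a b s t f : a <= s -> t <= b ->
  ioc_integrable a b f -> ioc_integrable s t f.
Proof.
move=> as_ tb; apply: integrableS => //.
by move=> x /=; rewrite !in_itv/= => /andP[sx xt]; lra.
Qed.

Lemma lebesgue_measure_ioc a b : a <= b -> leb `]a, b]%classic = (b - a)%:E.
Proof.
rewrite lebesgue_measure_itv/= lte_fin le_eqVlt => /predU1P[->|->].
  by rewrite ltxx subrr.
by rewrite EFinB.
Qed.

Lemma lebesgue_measure_ioc_lty a b : (leb `]a, b]%classic < +oo)%E.
Proof.
by rewrite lebesgue_measure_itv/=; case: ifPn => // _; rewrite -EFinB ltry.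
Qed.

Lemma ioc_integrable_cst a b c : ioc_integrable a b (fun=> c).
Proof.
apply: measurable_bounded_integrable => //; first exact: lebesgue_measure_ioc_lty.
exists `|c|; split; rewrite ?num_real// => M cM x _; exact: ltW.
Qed.

Lemma ioc_le_integrable a b f F : measurable_fun `]a, b] f ->
  (forall x, a < x <= b -> `|f x| <= `|F x|) ->
  ioc_integrable a b F -> ioc_integrable a b f.
Proof.
move=> mf fF; apply: le_integrable => //.
exact/measurable_EFinP.
Qed.

Lemma ioc_integrableD a b f F : ioc_integrable a b f -> ioc_integrable a b F ->
  ioc_integrable a b (fun x => f x + F x).
Proof.
by move=> intf intF; have := integrableD _ intf intF; apply.
Qed.

Lemma ioc_integrableZ a b f c : ioc_integrable a b f ->
  ioc_integrable a b (fun x => c * f x).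
Proof. by move=> intf; have := integrableZl _ c intf; apply. Qed.

Lemma ioc_int_cst s t c : s <= t -> ioc_int (fun=> c) s t = (t - s) * c.
Proof.
by move=> st; rewrite /ioc_int Rintegral_cst//= lebesgue_measure_ioc// mulrC.
Qed.

Lemma le_ioc_int s t f F : ioc_integrable s t f -> ioc_integrable s t F ->
  (forall x, s < x <= t -> f x <= F x) -> ioc_int f s t <= ioc_int F s t.
Proof.
move=> intf intF fF; apply: le_Rintegral => // x /=; rewrite in_itv/=; exact: fF.
Qed.

Lemma ioc_intD s t f F : ioc_integrable s t f -> ioc_integrable s t F ->
  ioc_int (fun x => f x + F x) s t = ioc_int f s t + ioc_int F s t.
Proof. by move=> intf intF; rewrite /ioc_int RintegralD. Qed.

Lemma ioc_intZ s t f c : ioc_integrable s t f ->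
  ioc_int (fun x => c * f x) s t = c * ioc_int f s t.
Proof. by move=> intf; rewrite /ioc_int RintegralZl. Qed.

Lemma ioc_int_split s r t f : s <= r -> r <= t -> ioc_integrable s t f ->
  ioc_int f s t = ioc_int f s r + ioc_int f r t.
Proof.
move=> sr rt intf; rewrite /ioc_int.
rewrite -[X in _ = _ + X](@Rintegral_itvB _ f (BRight s) (BRight t))//.
by rewrite addrC subrK.
Qed.

Lemma ioc_int_ge0 s t f : (forall x, s < x <= t -> 0 <= f x) -> 0 <= ioc_int f s t.
Proof. by move=> f0; apply: Rintegral_ge0 => x /=; rewrite in_itv/=; exact: f0. Qed.

Lemma EFin_ioc_int s t f : ioc_integrable s t f ->
  ((ioc_int f s t)%:E = \int[leb]_(x in `]s, t]) (f x)%:E)%E.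
Proof.
move=> intf; rewrite /ioc_int /Rintegral fineK//; exact: integrable_fin_num.
Qed.

Lemma ioc_int_id s f : ioc_int f s s = 0.
Proof. by rewrite /ioc_int set_itv_ge ?Rintegral_set0// bnd_simp ltxx. Qed.

Lemma ioc_int_cvg a b f r e : a <= b -> ioc_integrable a b f -> a <= r <= b ->
  0 < e -> exists2 d, 0 < d & forall s, a <= s <= b -> `|s - r| <= d ->
    `|ioc_int f a s - ioc_int f a r| <= e.
Proof.
move=> ab intf arb e0.
have intf' : leb.-integrable `[a, b] (EFin \o f).
  apply/integrableP; split.
    have /integrableP[/measurable_EFinP mf _] := intf.
    by apply/measurable_EFinP/measurable_fun_itv_obnd_cbndP.
  have /integrableP[mf] := intf.
  by rewrite integral_itv_obnd_cbnd//; exact: measurableT_comp.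
have /within_continuous_itvP H := parameterized_integral_continuous ab intf'.
have intE s : a <= s <= b -> parameterized_integral leb a s f = ioc_int f a s.
  move=> /andP[as_ sb]; rewrite /parameterized_integral /ioc_int.
  rewrite -Rintegral_itv_obnd_cbnd//.
  exact: (ioc_integrableS (lexx a) sb).
have [d d0 dH] := H r arb e e0; exists d => // s sab sr.
by rewrite -!intE//; exact: dH.
Qed.

End HalfOpenIntegrals.

(** * Integrable forcing terms *)

Section Forcing.
Context {R : realType} {X : normedModType R}.
Local Notation leb := (@lebesgue_measure R).
Implicit Types (g h f : R -> X) (c : X).

(** A Borel version of an integrable vector-valued function. *)
Definition forcing g : Prop :=
  @limit_simple _ (measurableTypeR R) R X g /\
  leb.-integrable setT (fun t => (`|g t|)%:E).

Lemma continuous_dist c : continuous (fun y : X => `|y - c|).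
Proof.
by move=> y; apply: (@continuous_comp _ _ _ (fun y => y - c) Num.norm);
  [apply: cvgB; [exact: cvg_id|exact: cvg_cst]|exact: norm_continuous].
Qed.

Lemma continuous_distl c : continuous (fun y : X => `|c - y|).
Proof.
rewrite (_ : (fun y => _) = (fun y => `|y - c|)); first exact: continuous_dist.
by apply/funext => y; rewrite distrC.
Qed.

Lemma forcing_measurable_dist g h : forcing g -> continuous h ->
  measurable_fun [set: measurableTypeR R] (fun t => `|g t - h t|).
Proof.
move=> [sg _] ch.
apply: (measurable_fun_caratheodory (F := fun t y => `|y - h t|) _ sg) => //.
  move=> y; apply: continuous_measurable_fun => t.
  by apply: (@continuous_comp _ _ _ h (fun z => `|y - z|));
    [exact: ch|exact: continuous_distl].
by move=> t _; exact: continuous_dist.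
Qed.

Lemma forcing_integrable g a b : forcing g -> ioc_integrable a b (fun t => `|g t|).
Proof. by move=> [_]; apply: integrableS. Qed.

Lemma forcing_dist_integrable g c a b : forcing g ->
  ioc_integrable a b (fun t => `|g t - c|).
Proof.
move=> fg; apply: (@ioc_le_integrable _ _ _ _ (fun t => `|g t| + `|c|)).
- apply: measurable_funTS; apply: (forcing_measurable_dist fg) => t.
  exact: cvg_cst.
- by move=> x _; rewrite normr_id [leRHS]ger0_norm ?addr_ge0// ler_normB.
- apply: ioc_integrableD; first exact: forcing_integrable.
  exact: ioc_integrable_cst.
Qed.

Variable T : R.

(** Approximation in mean by continuous functions, with the error bounded by an
    integrable function [F] so that no measurability of [f - h] is involved. *)
Definition mean_approximable f : Prop := forall e, 0 < e ->
  exists2 h, continuous h & exists F : R -> R,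
    [/\ ioc_integrable 0 T F, (forall x, 0 < x <= T -> `|f x - h x| <= F x) &
      ioc_int F 0 T <= e].

Lemma mean_approximableD f1 f2 : mean_approximable f1 -> mean_approximable f2 ->
  mean_approximable (fun x => f1 x + f2 x).
Proof.
move=> a1 a2 e e0; have e2 : 0 < e / 2 by lra.
have [h1 ch1 [F1 [i1 b1 e1]]] := a1 _ e2; have [h2 ch2 [F2 [i2 b2 e2']]] := a2 _ e2.
exists (fun x => h1 x + h2 x); first by move=> x; apply: cvgD; [exact: ch1|exact: ch2].
exists (fun x => F1 x + F2 x); split.
- exact: ioc_integrableD.
- move=> x xT; rewrite opprD addrACA (le_trans (ler_normD _ _))// lerD//.
    exact: b1.
  exact: b2.
- rewrite ioc_intD//; lra.
Qed.

Lemma mean_approximable_indic (E : set (measurableTypeR R)) (y : X) :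
  measurable E -> mean_approximable (fun x => \1_E x *: y).
Proof.
move=> mE e e0; pose M := `|y| + 1; have M0 : 0 < M by rewrite ltr_pwDr.
have i1 : leb.-integrable `]0, T] (EFin \o (\1_E : R -> R)).
  apply: measurable_bounded_integrable => //.
    exact: lebesgue_measure_ioc_lty.
  exists 1; split; rewrite ?num_real// => N N1 x _.
  apply: le_trans (ltW N1); rewrite /= indicE; by case: (_ \in _); rewrite ?normr1 ?normr0.
have [k_ [ck ik]] := approximation_continuous_integrable
  (measurable_itv `]0, T]) (lebesgue_measure_ioc_lty 0 T) i1.
have eM : 0 < e / M by rewrite divr_gt0.
move=> /fine_cvgP[fink /cvgrPdist_le/(_ _ eM) dk].
have [n [nfin nd]] : exists n, (\int[leb]_(z in `]0%R, T]) `|(\1_E z - k_ n z)%:E| \is a fin_num)%E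
   /\ `|0 - fine (\int[leb]_(z in `]0%R, T]) `|(\1_E z - k_ n z)%:E|)%E| <= e / M.
  near \oo => n; exists n; split; first by near: n; exact: fink.
  by near: n; exact: dk.
have iF : ioc_integrable 0 T (fun x => `|\1_E x - k_ n x|).
  have iB : leb.-integrable `]0, T] (fun x => (\1_E x - k_ n x)%:E).
    by have := integrableB _ i1 (ik n); apply.
  by have := integrable_abse iB; apply.
exists (fun x => k_ n x *: y).
  by move=> x; apply: cvgZ; [exact: ck|exact: cvg_cst].
exists (fun x => M * `|\1_E x - k_ n x|); split.
- exact: ioc_integrableZ.
- move=> x _; rewrite -scalerBl normrZ mulrC ler_wpM2r//.
  by rewrite /M lerDl.
- rewrite ioc_intZ// -ler_pdivlMl// mulrC.
  apply: le_trans nd; rewrite sub0r normrN; exact: ler_norm.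
Unshelve. all: by end_near. Qed.

Lemma mean_approximable_simple f :
  @simple_fun _ (measurableTypeR R) X f -> mean_approximable f.
Proof.
move=> [/finite_seqP[s fs] mf].
have -> : f = (fun x => \sum_(y <- undup s) \1_(f @^-1` [set y]) x *: y).
  apply/funext => x; have fx : f x \in undup s.
    by rewrite mem_undup; have /predeqP/(_ (f x))[+ _] := fs; apply; exists x.
  rewrite (bigD1_seq (f x)) ?undup_uniq//= big1 ?addr0.
    by rewrite indicE mem_set// scale1r.
  move=> y yfx; rewrite indicE memNset ?scale0r//= => fxy.
  by move: yfx; rewrite fxy eqxx.
elim: (undup s) => [|y r IH].
  move=> e e0; exists (fun=> 0); first by move=> x; exact: cvg_cst.
  exists (fun=> 0); split => //; first exact: ioc_integrable_cst.
    by move=> x _; rewrite big_nil subrr normr0.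
  have [T0|T0] := leP 0 T; first by rewrite ioc_int_cst// mulr0 ltW.
  by rewrite /ioc_int set_itv_ge ?Rintegral_set0 1?ltW// bnd_simp -leNgt ltW.
under [X in mean_approximable X]funext do rewrite big_cons.
apply: mean_approximableD IH; exact: mean_approximable_indic.
Qed.

(** Replacing [f_ n] by [0] where it is further from [g] than [0] is makes the
    error dominated by [g] itself. *)
Lemma forcing_approximable g : forcing g -> mean_approximable g.
Proof.
move=> fg e e0; have [[f_ sf f_g] _] := fg.
have mdist n : measurable_fun [set: measurableTypeR R] (fun t => `|g t - f_ n t|).
  apply: (measurable_fun_caratheodory (F := fun t y => `|y - f_ n t|) _ fg.1) => //.
    move=> y; apply: (measurable_fun_limit_simple (F := fun z => `|y - z|)).
      by exists (fun=> f_ n) => // x; exact: cvg_cst.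
    exact: continuous_distl.
  by move=> t _; exact: continuous_dist.
have mg : measurable_fun [set: measurableTypeR R] (fun t => `|g t|).
  apply: (measurable_fun_limit_simple (F := Num.norm) fg.1); exact: norm_continuous.
pose E n : set (measurableTypeR R) := [set t | `|g t - f_ n t| <= `|g t|].
have mE n : measurable (E n).
  have := measurable_fun_ler (mdist n) mg measurableT (Y := [set true]).
  by rewrite setTI; apply.
pose p n t := if t \in E n then f_ n t else 0.
have sp n : @simple_fun _ (measurableTypeR R) X (p n) by exact: simple_fun_patch.
have pg n t : `|g t - p n t| <= `|g t|.
  by rewrite /p; case: ifPn => [/set_mem//|_]; rewrite subr0.
have p_cvg t : p ^~ t @ \oo --> g t.
  have [g0|g0] := eqVneq (g t) 0.
    have -> : p ^~ t = fun=> g t; last exact: cvg_cst.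
    apply/funext => n; have := pg n t.
    by rewrite g0 normr0 sub0r normrN normr_le0 => /eqP.
  apply/cvgrPdist_le => d d0.
  have := f_g t; move=> /cvgrPdist_le/(_ (Num.min d `|g t|)).
  rewrite lt_min d0 normr_gt0 g0 => /(_ isT); apply: filterS => n.
  by rewrite le_min => /andP[gd gg]; rewrite /p mem_set.
have mp n : measurable_fun `]0, T] (fun t => `|g t - p n t|).
  apply: measurable_funTS.
  apply: (measurable_fun_caratheodory (F := fun t y => `|y - p n t|) _ fg.1) => //.
    move=> y; apply: (measurable_fun_limit_simple (F := fun z => `|y - z|)).
      by exists (fun=> p n) => // x; exact: cvg_cst.
    exact: continuous_distl.
  by move=> t _; exact: continuous_dist.
have ip n : ioc_integrable 0 T (fun t => `|g t - p n t|).
  apply: (ioc_le_integrable (mp n)) (forcing_integrable _ _ fg) => x _.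
  by rewrite normr_id normr_id.
have e2 : 0 < e / 2 by lra.
have [n ne] : exists n, ioc_int (fun t => `|g t - p n t|) 0 T <= e / 2.
  have [] := @dominated_convergence _ (measurableTypeR R) R leb `]0, T] _
    (fun n t => (`|g t - p n t|)%:E) (cst 0%E) (fun t => (`|g t|)%:E) => //.
  - by move=> n; apply/measurable_EFinP; exact: mp.
  - apply: aeW => t _; apply: cvg_EFin; first exact: nearW.
    have -> : (fine \o (fun n => (`|g t - p n t|)%:E)) = (fun n => `|g t - p n t|) by [].
    rewrite -[X in _ --> X](normr0 X) -[X in `|X|](subrr (g t)).
    by apply: cvg_norm; apply: cvgB; [exact: cvg_cst|exact: p_cvg].
  - exact: (forcing_integrable 0 T fg).
  - by apply: aeW => t n _ /=; rewrite lee_fin normr_id.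
  move=> _ _; rewrite integral0 => /fine_cvgP[_ /cvgrPdist_le/(_ _ e2)].
  move=> [n _ /(_ n (leqnn n))] /=; rewrite sub0r normrN => H; exists n.
  exact: le_trans (ler_norm _) H.
have [h ch [F [iF bF eF]]] := mean_approximable_simple (sp n) e2.
exists h => //; exists (fun t => `|g t - p n t| + F t); split.
- exact: ioc_integrableD.
- move=> x xT; rewrite -[g x](subrK (p n x)) -addrA (le_trans (ler_normD _ _))//.
  by rewrite subrK lerD2l bF.
- rewrite ioc_intD//; lra.
Qed.

Lemma forcing_continuous_approx g e : forcing g -> 0 < e -> exists2 h,
  continuous h & ioc_integrable 0 T (fun t => `|g t - h t|) /\
  ioc_int (fun t => `|g t - h t|) 0 T <= e.
Proof.
move=> fg e0; have [h ch [F [iF bF eF]]] := forcing_approximable fg e0.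
exists h => //.
have i : ioc_integrable 0 T (fun t => `|g t - h t|).
  apply: (@ioc_le_integrable _ _ _ _ F) => //.
    apply: measurable_funTS; exact: forcing_measurable_dist.
  by move=> x xT; rewrite normr_id (le_trans (bF x xT))// ler_norm.
split=> //; apply: le_trans eF; exact: le_ioc_int.
Qed.

Lemma bochner_forcing g : bochner_L1 leb `]0, T[ g ->
  exists2 g', forcing g' & {ae leb, forall t, 0 < t -> t <= T -> g t = g' t}.
Proof.
move=> [sg ig].
have [|g' [sg' g'0 gg']] := strongly_measurable_representative _ sg => //.
exists g'.
  split=> //; have mg' : measurable_fun [set: measurableTypeR R] (fun t => `|g' t|).
    apply: (measurable_fun_limit_simple (F := Num.norm) sg'); exact: norm_continuous.
  apply/integrableP; split; first exact/measurable_EFinP.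
  have -> : (\int[leb]_x `|(`|g' x|)%:E| = \int[leb]_(x in `]0%R, T[) (`|g x|)%:E)%E => //.
  rewrite [RHS]integral_mkcond; apply: integral_ae_eq.
  apply: filterS gg' => t /= gt _; rewrite normr_id /patch.
  case: ifPn => [/set_mem/= /gt ->//|/negP nt]; rewrite g'0 ?normr0// => tD.
  by apply: nt; rewrite mem_set.
have nT : {ae leb, forall t, t <> T}.
  exists [set T]; split => //; first exact: lebesgue_measure_set1.
  by move=> t /= /contrapT.
apply: filterS2 gg' nT => t gt tT t0 tT'; apply: gt => /=.
by rewrite in_itv/= t0 lt_neqAle tT' andbT; apply/eqP.
Qed.

End Forcing.

(** * Comparison of distance profiles with an Euler scheme *)

Section FirstTouching.
Context {R : realType}.

(** At the last time [s0] before [t] at which [D s <= e * s], the left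
    hypothesis gives [D s0 <= e * s0], and just after [s0] the function [D] is
    nonnegative, so the right hypothesis prevents it from outgrowing [e * s]. *)
Lemma first_touching (D : R -> R) (T : R) : D 0 <= 0 ->
  (forall t, 0 < t <= T -> forall e, 0 < e -> exists2 d, 0 < d &
    forall s, 0 <= s <= t -> t - s <= d -> D t <= D s + e) ->
  (forall s, 0 <= s < T -> forall e, 0 < e -> exists2 d, 0 < d &
    forall t, s < t <= T -> t - s <= d -> (forall r, s < r <= t -> 0 <= D r) ->
    D t - D s <= e * (t - s)) ->
  forall t, 0 <= t <= T -> D t <= 0.
Proof.
move=> D0 Dleft Dright t1 /andP[t10 t1T].
suff H e : 0 < e -> D t1 <= e * t1.
  apply/ler_addgt0Pr => e e0; rewrite add0r.
  have t11 : 0 < t1 + 1 by lra.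
  have := H (e / (t1 + 1)) (divr_gt0 e0 t11); move/le_trans; apply.
  by rewrite mulrAC ler_pdivrMr// ler_wpM2l//; lra.
move=> e0; rewrite leNgt; apply/negP => Dt1.
pose S := [set s | 0 <= s <= t1 /\ D s <= e * s].
have S0 : S 0 by split; rewrite ?lexx ?mulr0.
have hS : has_sup S by split; [exists 0|exists t1 => s [/andP[]]].
pose s0 := sup S.
have s00 : 0 <= s0 by apply: ub_le_sup S0; exact: hS.2.
have s0t1 : s0 <= t1 by apply: ge_sup; [exists 0|move=> s [/andP[]]].
have Ds0 : D s0 <= e * s0.
  move: (s00); rewrite le_eqVlt => /predU1P[<-|s0p]; first by rewrite mulr0.
  apply/ler_addgt0Pr => e' e'0.
  have [d d0 dH] := Dleft s0 (introT andP (conj s0p (le_trans s0t1 t1T))) e' e'0.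
  have [s [/andP[s_0 st1] Ds] ss0] := sup_adherent d0 hS.
  have ss0' : s <= s0 by apply: ub_le_sup; [exact: hS.2|split; rewrite ?s_0].
  have := dH s; rewrite s_0 ss0' => /(_ isT) H.
  apply: le_trans (H _) _; first by rewrite -/s0 in ss0; lra.
  by rewrite lerD2r (le_trans Ds)// ler_wpM2l// ltW.
have s0t1' : s0 < t1.
  by rewrite lt_neqAle s0t1 andbT; apply/eqP => E; rewrite E in Ds0; lra.
have [d d0 dH] := Dright s0 (introT andP (conj s00 (lt_le_trans s0t1' t1T))) e e0.
pose t := Num.min t1 (s0 + d).
have s0t : s0 < t by rewrite lt_min s0t1' ltrDl.
have tt1 : t <= t1 by rewrite ge_min lexx.
have td : t <= s0 + d by rewrite ge_min lexx orbT.
have : S t.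
  split; first by rewrite tt1 andbT; lra.
  have := dH t; rewrite s0t (le_trans tt1 t1T) => /(_ isT).
  have td' : t - s0 <= d by lra.
  move=> /(_ td')H; have {}H := H _; rewrite -(subrK (D s0) (D t)).
  have -> : e * t = e * (t - s0) + e * s0 by ring.
  apply: lerD => //; apply: H => r /andP[s0r rt].
  rewrite leNgt; apply/negP => Dr; suff : r <= s0 by lra.
  apply: ub_le_sup; first exact: hS.2.
  split; first by apply/andP; split; lra.
  by rewrite ltW// (lt_le_trans Dr)// mulr_ge0//; lra.
by move=> St; have := ub_le_sup hS.2 St; rewrite -/s0; lra.
Qed.

End FirstTouching.

Section Comparison.
Context {R : realType} {X : normedModType R}.
Variable A : set (X * X).
Hypothesis mA : m_accretive A.

(** The properties shared by [fun t x => `|w t - x|] for an integral solution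
    [w] and by its average over [alpha] for an integral-process solution, that
    make them comparable with an Euler scheme.  Along a step [x'] to [x] the
    bracket in the integral inequality is at most a difference quotient, see
    [bracket_le_norm]; [B] bounds its numerator. *)
Definition distance_profile (g : R -> X) (u0 : X) (T : R) (phi : R -> X -> R) :=
  (forall x, op_domain A x -> phi 0 x <= `|u0 - x|) /\
  forall x x' c l, 0 < l -> A (x, c - l^-1 *: (x - x')) -> op_domain A x' ->
  forall s t B, 0 <= s <= t -> t <= T ->
    (forall r, s < r <= t -> phi r x' - phi r x <= B) ->
    phi t x - phi s x <= ioc_int (fun r => `|g r - c|) s t + (t - s) / l * B.

Lemma distance_profile_le (g : R -> X) u0 T phi x z : distance_profile g u0 T phi ->
  A (x, z) -> forall s t, 0 <= s <= t -> t <= T ->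
  phi t x - phi s x <= ioc_int (fun r => `|g r - z|) s t.
Proof.
move=> [_ H] Axz s t st tT.
have := H x x z 1 ltr01; rewrite subrr scaler0 subr0 => /(_ Axz).
have Dx : op_domain A x by exists z.
move=> /(_ Dx s t 0 st tT); rewrite mulr0 addr0; apply.
by move=> r _; rewrite subrr.
Qed.

Context (g h : R -> X) (u0 : X) (T : R) (phi : R -> X -> R) (L e M : R) (x y : X).
Hypothesis T0 : 0 < T.
Hypothesis fg : forcing g.
Hypothesis igh : ioc_integrable 0 T (fun t => `|g t - h t|).
Hypothesis profile : distance_profile g u0 T phi.
Hypothesis L0 : 0 <= L.
Hypothesis e0 : 0 <= e.
Hypothesis hL : forall s t, 0 <= s <= T -> 0 <= t <= T ->
  `|h s - h t| <= e + L * `|s - t|.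
Hypothesis Axy : A (x, y).
Hypothesis hM : forall s, 0 <= s <= T -> `|h s - y| <= M.

Local Notation gap := (ioc_int (fun r => `|g r - h r|)).

Lemma dist_int_le c C s t : 0 <= s <= t -> t <= T ->
  (forall r, s < r <= t -> `|h r - c| <= C) ->
  ioc_int (fun r => `|g r - c|) s t <= gap s t + (t - s) * C.
Proof.
move=> /andP[s0 st] tT hC; rewrite -ioc_int_cst//.
have i1 := ioc_integrableS s0 tT igh.
rewrite -ioc_intD//; last exact: ioc_integrable_cst.
apply: le_ioc_int.
- exact: forcing_dist_integrable.
- by apply: ioc_integrableD => //; exact: ioc_integrable_cst.
- move=> r rst; apply: le_trans (lerD (lexx _) (hC r rst)).
  by rewrite (le_trans _ (ler_normD _ _))// addrA subrK.
Qed.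

Lemma gap_split s t : 0 <= s <= t -> t <= T -> gap 0 t = gap 0 s + gap s t.
Proof.
move=> /andP[s0 st] tT; apply: ioc_int_split => //.
exact: (ioc_integrableS (lexx 0) tT).
Qed.

Lemma gap_ge0 s t : 0 <= gap s t.
Proof. by apply: ioc_int_ge0. Qed.

(** Continuous analogue of [euler_compare]: writing [phi_i] for the profile at the
    [i]-th point of the scheme, the bound is a supersolution of the inequality
    [phi_i' <= `|g - h_i| + (phi_(i-1) - phi_i) / l].  A profile need not be
    continuous; it can only jump downwards, which is what [first_touching]
    requires on the left. *)
Lemma profile_euler_le eta l i : 0 < eta -> 0 < l -> i%:R * l <= T ->
  forall t, 0 <= t <= T -> phi t (euler A l h x i) <=
    `|u0 - x| + gap 0 t + (M + L * t) * qbound eta (t - i%:R * l) (l * t) + e * t.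
Proof.
move=> eta0 l0.
have M0 : 0 <= M by apply: le_trans (hM (s := 0) _) => //; rewrite lexx ltW.
have Dx : op_domain A x by exists y.
elim: i => [_ t /andP[t0 tT]|i IH iT].
  have /= := distance_profile_le profile Axy (s := 0) (t := t).
  rewrite lexx t0 => /(_ isT tT); have := profile.1 _ Dx.
  have := @dist_int_le y M 0 t; rewrite lexx t0 => /(_ isT tT).
  have hMt : forall r, 0 < r <= t -> `|h r - y| <= M.
    by move=> r /andP[r0 rt]; apply: hM; lra.
  move=> /(_ hMt); rewrite mul0r subr0.
  have := qbound_ge t eta0 (mulr_ge0 (ltW l0) t0); rewrite (ger0_norm t0) /=.
  set q := qbound _ _ _; have := mulr_ge0 L0 t0; have := mulr_ge0 e0 t0.
  move: (phi t x) (phi 0 x) (gap 0 t) (ioc_int _ _ _) (`|u0 - x|).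
  by move=> *; nra.
have iS : i.+1%:R * l = i%:R * l + l by rewrite -natr1 mulrDl mul1r.
have {}IH := IH (le_trans _ iT); have {}IH : forall t, 0 <= t <= T ->
    phi t (euler A l h x i) <= `|u0 - x| + gap 0 t +
      (M + L * t) * qbound eta (t - i%:R * l) (l * t) + e * t.
  by apply: IH; rewrite iS; lra.
set a := i.+1%:R * l in iS iT *.
have Ap := euler_graph mA h x i l0; rewrite -/a in Ap.
set p := euler A l h x i.+1 in Ap *; set p0 := euler A l h x i in Ap IH.
have Dp0 : op_domain A p0 by exact: euler_domain.
have Dp : op_domain A p by exact: euler_domain.
pose q t := qbound eta (t - a) (l * t).
pose G t := `|u0 - x| + gap 0 t + (M + L * t) * q t + e * t.
suff H : forall t, 0 <= t <= T -> phi t p - G t <= 0.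
  by move=> t tT; have := H t tT; rewrite /G /q; lra.
have a0 : 0 <= a by rewrite mulr_ge0// ltW.
have cG1 : continuous (fun t => (M + L * t) * q t + e * t).
  move=> t; rewrite /q /qbound.
  apply: cvgD; last by apply: cvgM; [exact: cvg_cst|exact: cvg_id].
  apply: cvgM.
    by apply: cvgD; [exact: cvg_cst|apply: cvgM; [exact: cvg_cst|exact: cvg_id]].
  apply: cvgM; last exact: cvg_cst.
  apply: cvgD; first exact: cvg_cst.
  apply: cvgM; last exact: cvg_cst.
  apply: cvgD; last by apply: cvgM; [exact: cvg_cst|exact: cvg_id].
  by apply: cvgM; apply: cvgB; try exact: cvg_id; exact: cvg_cst.
apply: first_touching.
- have := profile.1 _ Dp; rewrite /G ioc_int_id mulr0 !addr0 mulr0 addr0.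
  have := euler_near_start mA Axy hM l0 iT; rewrite -/p -/a.
  have := @qbound_ge _ eta (0 - a) (l * 0) eta0; rewrite mulr0 lexx => /(_ isT).
  rewrite sub0r normrN (ger0_norm a0) /q mulr0 sub0r => qa.
  have := ler_distD x u0 p; rewrite [`|p - x|]distrC.
  set Q := qbound _ _ _ in qa *.
  by have : M * a <= M * Q; [rewrite ler_wpM2l|lra].
- (* The integral that bounds an increase of the profile and the increments of
     [G] are small over short intervals. *)
  move=> t /andP[t0 tT] d d0.
  have [z Az] := Dp.
  have T0' := ltW T0.
  have tT' : 0 <= t <= T by apply/andP; split; lra.
  have d2 : 0 < d / 2 by lra.
  have [d1 d10 H1] := ioc_int_cvg T0' (forcing_dist_integrable z 0 T fg) tT' d2.
  have /cvgrPdist_le/(_ _ d2)/nbhs_ballP[d2' d20 H2] := cG1 t.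
  exists (Num.min d1 (d2' / 2)); first by rewrite lt_min d10/=; rewrite /= in d20; lra.
  move=> s /andP[s0 st]; rewrite le_min => /andP[td1 td2].
  have sT : 0 <= s <= T by apply/andP; split; lra.
  have stb : 0 <= s <= t by rewrite s0.
  have := distance_profile_le profile Az stb tT.
  have := H1 s sT; rewrite distrC ger0_norm ?subr_ge0// => /(_ td1).
  rewrite (ioc_int_split s0 st (forcing_dist_integrable z 0 t fg)).
  rewrite opprD addrA subrr sub0r normrN.
  rewrite ger0_norm; last by apply: ioc_int_ge0.
  have := H2 s; rewrite /ball /= ger0_norm ?subr_ge0//; rewrite /= in d20.
  have -> : t - s < d2' by lra.
  move=> /(_ isT); rewrite ler_norml => /andP[+ _].
  rewrite /G; have := gap_split stb tT; have := gap_ge0 s t.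
  by rewrite /= in td1 *; lra.
- move=> s /andP[s0 sT] d d0; have d2 : 0 < d / 2 by lra.
  (* The bounds for two consecutive indices differ by [l * K r] at time [r]; the
     increment of [(M + L * r) * q r] from [s] to [t] is
     [(t - s) * (W t + L * (t - s) + L * q s)]. *)
  pose K r := (M + L * r) * ((2 * (r - a) + l) / (2 * eta)).
  pose W r := (M + L * r) * ((r + s - 2 * a + l) / (2 * eta)) - L * (r - s).
  have cK : continuous K.
    move=> t; apply: cvgM.
      by apply: cvgD; [exact: cvg_cst|apply: cvgM; [exact: cvg_cst|exact: cvg_id]].
    apply: cvgM; last exact: cvg_cst.
    apply: cvgD; last exact: cvg_cst.
    apply: cvgM; first exact: cvg_cst.
    by apply: cvgB; [exact: cvg_id|exact: cvg_cst].
  have cW : continuous W.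
    move=> t; apply: cvgB; last first.
      apply: cvgM; first exact: cvg_cst.
      by apply: cvgB; [exact: cvg_id|exact: cvg_cst].
    apply: cvgM.
      by apply: cvgD; [exact: cvg_cst|apply: cvgM; [exact: cvg_cst|exact: cvg_id]].
    apply: cvgM; last exact: cvg_cst.
    apply: cvgD; last exact: cvg_cst.
    apply: cvgB; last exact: cvg_cst.
    by apply: cvgD; [exact: cvg_id|exact: cvg_cst].
  have WK : W s = K s.
    by rewrite /W /K subrr mulr0 subr0; congr (_ * (_ / _)); ring.
  have /cvgrPdist_le/(_ _ d2)/nbhs_ballP[d1 /= d10 H1] := cK s.
  have /cvgrPdist_le/(_ _ d2)/nbhs_ballP[d3 /= d30 H3] := cW s.
  exists (Num.min (d1 / 2) (d3 / 2)); first by rewrite lt_min; apply/andP; split; lra.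
  move=> t /andP[st tT]; rewrite le_min => /andP[td1 td3] Dpos.
  have stb : 0 <= s <= t by apply/andP; split; lra.
  have HB r : s < r <= t -> phi r p0 - phi r p <= l * (K s + d / 2).
    move=> /andP[sr rt]; have rT : 0 <= r <= T by apply/andP; split; lra.
    have := IH r rT; have := Dpos r; rewrite sr rt => /(_ isT).
    have := H1 r; rewrite /ball /= ltr0_norm ?subr_lt0//.
    have -> : - (s - r) < d1 by lra.
    move=> /(_ isT); rewrite ler_norml => /andP[+ _].
    rewrite /G /q => HK Hd Hi.
    have : (M + L * r) * qbound eta (r - i%:R * l) (l * r) =
      (M + L * r) * qbound eta (r - a) (l * r) + l * K r.
      by rewrite /K /qbound iS; field; rewrite gt_eqF.
    have : l * K r <= l * (K s + d / 2) by rewrite ler_pM2l//; lra.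
    lra.
  have := profile.2 p p0 (h a) l l0 Ap Dp0 s t _ stb tT HB.
  have -> : (t - s) / l * (l * (K s + d / 2)) = (t - s) * (K s + d / 2).
    by field; rewrite gt_eqF.
  have aT : 0 <= a <= T by rewrite a0.
  have hC r : s < r <= t -> `|h r - h a| <= e + L * (`|s - a| + (t - s)).
    move=> /andP[sr rt]; have rT : 0 <= r <= T by apply/andP; split; lra.
    apply: le_trans (hL rT aT) _; rewrite lerD2l ler_wpM2l//.
    by have := ler_distD s r a; rewrite [`|r - s|]gtr0_norm ?subr_gt0//; lra.
  have := dist_int_le stb tT hC.
  rewrite /G (gap_split stb tT) => I1 I2.
  have := H3 t; rewrite /ball /= ltr0_norm ?subr_lt0//.
  have -> : - (s - t) < d3 by lra.
  move=> /(_ isT); rewrite ler_norml => /andP[_].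
  rewrite WK => HW.
  have qs : `|s - a| <= q s by apply: qbound_ge => //; rewrite mulr_ge0// ltW.
  have -> : phi t p - (`|u0 - x| + (gap 0 s + gap s t) + (M + L * t) * q t + e * t)
     - (phi s p - (`|u0 - x| + gap 0 s + (M + L * s) * q s + e * s)) =
     phi t p - phi s p - gap s t - (t - s) * e -
     ((M + L * t) * q t - (M + L * s) * q s) by ring.
  have -> : (M + L * t) * q t - (M + L * s) * q s =
     (t - s) * (W t + L * (t - s) + L * q s).
    by rewrite /q /qbound /W; field; rewrite gt_eqF.
  have ts : 0 < t - s by lra.
  have Lqs : L * `|s - a| <= L * q s by rewrite ler_wpM2l.
  have : (t - s) * (e + L * (`|s - a| + (t - s))) + (t - s) * (K s + d / 2) <=
     (t - s) * (e + (W t + L * (t - s) + L * q s) + d).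
    rewrite -mulrDr ler_pM2l//; lra.
  move: I1 I2; rewrite !mulrDr; lra.
Qed.

End Comparison.

(** * Moduli of continuity and limits *)

Section ModulusOfContinuity.
Context {R : realType} {X : normedModType R}.

Lemma continuous_itv_uniform (h : R -> X) (T e : R) : continuous h -> 0 < e ->
  exists2 d, 0 < d & forall s t, 0 <= s <= T -> `|t - s| <= d -> `|h t - h s| <= e.
Proof.
move=> ch e0; have /compact_near_coveringP := @segment_compact R 0 T.
move=> /(_ _ (0^'+) (fun d s => forall t, `|t - s| <= d -> `|h t - h s| <= e)).
case.
  move=> s _; have e2 : 0 < e / 2 by lra.
  have /cvgrPdist_le/(_ _ e2)/nbhs_ballP[r /= r0 hr] := ch s.
  exists (ball s (r / 2), [set d | d < r / 2]).
    split; first by apply: nbhsx_ballx; lra.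
    by apply: nbhs_right_lt; lra.
  move=> [s' d] [/= ss' dr] t tsd; rewrite /ball /= in ss'.
  have h1 : `|h s - h s'| <= e / 2 by apply: hr; rewrite /ball /=; lra.
  have h2 : `|h s - h t| <= e / 2.
    apply: hr; rewrite /ball /=; have := ler_distD s' s t.
    by rewrite [`|s' - t|]distrC; lra.
  have := ler_distD (h s) (h t) (h s'); rewrite [`|h t - h s|]distrC; lra.
move=> d /= d0 dH; exists (d / 2); first lra.
move=> s t sT; apply: dH => /=; rewrite ?in_itv//= ?sub0r ?normrN ?gtr0_norm//; lra.
Qed.

(** Replacement for Lipschitz continuity: an arbitrarily small defect [e] buys a
    linear modulus. *)
Lemma continuous_itv_modulus (h : R -> X) (y : X) (T : R) : 0 <= T ->
  continuous h -> exists2 M, (forall s, 0 <= s <= T -> `|h s - y| <= M) &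
  forall e, 0 < e -> exists2 L, 0 <= L & forall s t, 0 <= s <= T -> 0 <= t <= T ->
    `|h s - h t| <= e + L * `|s - t|.
Proof.
move=> T0 ch.
have [M hM] : exists M, forall s, 0 <= s <= T -> `|h s - y| <= M.
  have /compact_bounded[M [_ MH]] : compact (h @` `[0, T]).
    apply: continuous_compact; last exact: segment_compact.
    exact: continuous_subspaceT.
  exists (M + 1 + `|y|) => s sT; apply: le_trans (ler_normB _ _) _.
  rewrite lerD2r; apply: (MH (M + 1)); first lra.
  by exists s.
have M0 : 0 <= M by apply: le_trans (hM 0 _) => //; rewrite lexx.
exists M => // e e0; have [d d0 dH] := continuous_itv_uniform T ch e0.
exists (2 * M / d); first by rewrite divr_ge0// ?mulr_ge0// ltW.
move=> s t sT tT; have [st|st] := leP `|s - t| d.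
  by apply: le_trans (dH t s tT st) _; rewrite lerDl !mulr_ge0// invr_ge0 ltW.
have H : 2 * M <= 2 * M / d * `|s - t|.
  rewrite mulrAC ler_pdivlMr// ler_wpM2l// ?mulr_ge0//; exact: ltW.
have := ler_distD y (h s) (h t); rewrite [`|y - h t|]distrC.
have := hM s sT; have := hM t tT; lra.
Qed.

Lemma harmonic_cauchy_limit (Y : completeNormedModType R) (a : nat -> Y) (c : R) :
  0 <= c ->
  (forall k m, `|a k - a m| <= c * (k.+1%:R^-1 + m.+1%:R^-1)) ->
  exists l, forall k, `|l - a k| <= 2 * c * k.+1%:R^-1.
Proof.
move=> c0 ac.
have anti k m : (k <= m)%N -> m.+1%:R^-1 <= k.+1%:R^-1 :> R.
  by move=> km; rewrite lef_pV2 ?posrE// ler_nat.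
have /cauchy_cvg/cvg_ex[l al] : cauchy (a @ \oo).
  apply: cauchy_exP => e e0.
  have [k ke] : exists k : nat, 2 * c * k.+1%:R^-1 < e.
    have c1 : 0 < e / (2 * c + 1) by rewrite divr_gt0// ltr_wpDl// mulr_ge0.
    have [k _ /(_ k (leqnn k))] := near_infty_natSinv_lt (PosNum c1).
    rewrite /= ltr_pdivlMr; last lra.
    move=> p; exists k; have : 0 < k.+1%:R^-1 :> R by rewrite invr_gt0.
    by move: (k.+1%:R^-1) p => z; lra.
  exists (a k); exists k => // m /= km; rewrite -ball_normE /=.
  apply: le_lt_trans ke; apply: le_trans (ac _ _) _.
  have -> : 2 * c * k.+1%:R^-1 = c * (k.+1%:R^-1 + k.+1%:R^-1) by ring.
  by rewrite ler_wpM2l// lerD2l anti.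
exists l => k; have cl : `|a m - a k| @[m --> \oo] --> `|l - a k|.
  by apply: cvg_norm; apply: cvgB; [exact: al|exact: cvg_cst].
apply: cvgr_to_le cl _; exists k => // m /= km; apply: le_trans (ac _ _) _.
have -> : 2 * c * k.+1%:R^-1 = c * (k.+1%:R^-1 + k.+1%:R^-1) by ring.
  by rewrite ler_wpM2l// lerD2r anti.
Qed.

End ModulusOfContinuity.

(** * Convergence of the Euler schemes *)

Section EulerConvergence.
Context {R : realType} {X : completeNormedModType R}.
Variable A : set (X * X).
Hypothesis mA : m_accretive A.
Context (g : R -> X) (u0 : X) (T : R).
Hypothesis T0 : 0 < T.
Hypothesis fg : forcing g.
Hypothesis Du0 : closure (op_domain A) u0.

Definition mesh (n : nat) : R := T / n%:R.

Lemma mesh_gt0 n : (0 < n)%N -> 0 < mesh n.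
Proof. by move=> n0; rewrite divr_gt0// ltr0n. Qed.

Lemma mulr_mesh n : (0 < n)%N -> n%:R * mesh n = T.
Proof. by move=> n0; rewrite mulrC divfK// pnatr_eq0 -lt0n. Qed.

Lemma mesh_le n i : (i <= n)%N -> i%:R * mesh n <= T.
Proof.
case: n => [|n]; first by rewrite leqn0 => /eqP ->; rewrite mul0r ltW.
move=> i_n; rewrite -(@mulr_mesh n.+1)// ler_wpM2r ?ler_nat//.
exact/ltW/mesh_gt0.
Qed.

Lemma mesh_decr n m : (0 < n)%N -> (n <= m)%N -> mesh m <= mesh n.
Proof.
move=> n0 nm; rewrite ler_pM2l// lef_pV2 ?posrE ?ltr0n ?ler_nat//.
exact: leq_trans nm.
Qed.

Lemma mesh_small d : 0 < d -> exists2 n, (0 < n)%N & mesh n <= d.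
Proof.
move=> d0; have dT : 0 < d / T by rewrite divr_gt0.
have [n _ /(_ n (leqnn n))/ltW] := near_infty_natSinv_lt (PosNum dT).
by rewrite /= ler_pdivlMr// mulrC => H; exists n.+1.
Qed.

Definition grid_index n t : nat := `|Num.ceil (t / mesh n)|%N.

Lemma grid_indexP n t : (0 < n)%N -> 0 <= t <= T ->
  (grid_index n t <= n)%N /\
  (grid_index n t)%:R * mesh n - mesh n < t <= (grid_index n t)%:R * mesh n.
Proof.
move=> n0 /andP[t0 tT]; have l0 := mesh_gt0 n0.
have c0 : 0 <= Num.ceil (t / mesh n).
  by rewrite ceil_ge0 (lt_le_trans (ltrN10 R))// divr_ge0// ltW.
have E : (grid_index n t)%:R = (Num.ceil (t / mesh n))%:~R :> R.
  by rewrite /grid_index -[in RHS](gez0_abs c0) -pmulrn.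
have /andP[H1 H2] := ceil_itv (t / mesh n).
split.
  rewrite -lez_nat /grid_index gez0_abs// ceil_le_int.
  by rewrite -pmulrn ler_pdivrMr// mulr_mesh.
rewrite E; apply/andP; split; last by rewrite -ler_pdivrMr.
by move: H1; rewrite intrD mulrN1z ltr_pdivlMr// mulrBl mul1r.
Qed.

Lemma grid_index_eq n i t : (0 < n)%N ->
  i%:R * mesh n < t <= i.+1%:R * mesh n -> grid_index n t = i.+1.
Proof.
move=> n0 /andP[it ti]; have l0 := mesh_gt0 n0.
rewrite /grid_index (_ : Num.ceil _ = i.+1%:Z)//.
apply: ceil_def; rewrite -addn1 PoszD addrK -!pmulrn addn1.
by rewrite ltr_pdivlMr// ler_pdivrMr// it.
Qed.

Lemma grid_index0 n : grid_index n 0 = 0%N.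
Proof. by rewrite /grid_index mul0r ceil0. Qed.

(** The error of the uniform grid as a discretization of [g]. *)
Definition forcing_error (h : R -> X) n : R := \sum_(i < n)
  ioc_int (fun r => `|g r - h (i.+1%:R * mesh n)|) (i%:R * mesh n)
    (i.+1%:R * mesh n).

Local Notation gap h := (ioc_int (fun r => `|g r - h r|)).

Lemma forcing_error_le (h : R -> X) e : continuous h -> 0 < e ->
  ioc_integrable 0 T (fun t => `|g t - h t|) ->
  exists2 d, 0 < d & forall n, (0 < n)%N -> mesh n <= d ->
    forcing_error h n <= gap h 0 T + e.
Proof.
move=> ch e0 igh; have eT : 0 < e / T by rewrite divr_gt0.
have [d d0 dH] := continuous_itv_uniform T ch eT.
exists d => // n n0 nd; rewrite /forcing_error; have l0 := mesh_gt0 n0.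
have nS k : k.+1%:R * mesh n = k%:R * mesh n + mesh n :> R.
  by rewrite -natr1 mulrDl mul1r.
have pos k : 0 <= k%:R * mesh n by rewrite mulr_ge0// ltW.
suff H k : (k <= n)%N -> \sum_(i < k)
    ioc_int (fun r => `|g r - h (i.+1%:R * mesh n)|) (i%:R * mesh n)
      (i.+1%:R * mesh n) <= gap h 0 (k%:R * mesh n) + k%:R * mesh n * (e / T).
  have := H n (leqnn n); rewrite mulr_mesh//.
  by rewrite [T * (e / T)]mulrC divfK// gt_eqF.
elim: k => [_|k IH kn].
  by rewrite big_ord0 !mul0r addr0 ioc_int_id.
rewrite big_ord_recr /=; have {}IH := IH (ltnW kn).
have kT := mesh_le kn; have := pos k; have := nS k.
set a := k%:R * mesh n in IH *; set b := k.+1%:R * mesh n in kT * => bE a0.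
have ab : 0 <= a <= b by rewrite a0 bE lerDl ltW.
have bT : 0 <= b <= T by rewrite pos.
have hb r : a < r <= b -> `|h r - h b| <= e / T.
  move=> /andP[ar rb]; apply: dH => //.
  by apply: le_trans nd; rewrite ler0_norm; lra.
have := dist_int_le fg igh ab kT hb.
have -> : b - a = mesh n by rewrite bE addrC addKr.
rewrite (gap_split igh ab kT) bE; lra.
Qed.

Lemma euler_stable_mesh (h k : R -> X) x z n i : (i <= n)%N ->
  `|euler A (mesh n) h x i - euler A (mesh n) k z i| <=
    `|x - z| + (forcing_error h n + forcing_error k n).
Proof.
move=> i_n; case: (posnP n) => [n0|n0].
  move: i_n; rewrite n0 leqn0 => /eqP -> /=.
  by rewrite /forcing_error !big_ord0 !addr0.
have l0 := mesh_gt0 n0.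
apply: le_trans (euler_stable mA h k x z i l0) _; rewrite lerD2l.
rewrite /forcing_error -big_split /= -(subnKC i_n) big_split_ord /=.
rewrite -[leLHS]addr0; apply: lerD; last first.
  apply: sumr_ge0 => j _; apply: addr_ge0; exact: ioc_int_ge0.
rewrite subnKC//; apply: ler_sum => j _.
set a := j%:R * mesh n; set b := j.+1%:R * mesh n.
have ba : b - a = mesh n by rewrite /b -natr1 mulrDl mul1r addrC addKr.
have ab : a <= b by rewrite -subr_ge0 ba ltW.
rewrite -ba -ioc_int_cst// -ioc_intD; last 2 first.
  exact: forcing_dist_integrable.
  exact: forcing_dist_integrable.
apply: le_ioc_int; first exact: ioc_integrable_cst.
  by apply: ioc_integrableD; exact: forcing_dist_integrable.
move=> r _; have := ler_distD (g r) (h b) (k b).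
by rewrite [`|h b - g r|]distrC.
Qed.

(** Both comparison estimates, with their parameters chosen: first the defect
    [e] of the modulus of continuity, then [eta], then the step. *)
Lemma euler_cauchy_profile (h : R -> X) x y e : continuous h -> A (x, y) ->
  ioc_integrable 0 T (fun t => `|g t - h t|) -> 0 < e ->
  exists2 d, 0 < d &
    (forall l m i j, 0 < l <= d -> 0 < m <= d -> i%:R * l <= T -> j%:R * m <= T ->
       `|i%:R * l - j%:R * m| <= d ->
       `|euler A l h x i - euler A m h x j| <= e) /\
    (forall l i phi, 0 < l <= d -> i%:R * l = T -> distance_profile A g u0 T phi ->
       phi T (euler A l h x i) <= `|u0 - x| + gap h 0 T + e).
Proof.
move=> ch Axy igh e0; have T0' := ltW T0.
have [M hM hmod] := continuous_itv_modulus y T0' ch.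
have M0 : 0 <= M by apply: le_trans (hM 0 _) => //; rewrite lexx.
pose e1 := e / (4 * T); have e10 : 0 < e1 by rewrite divr_gt0// mulr_gt0.
have e1T : e1 * T = e / 4 by rewrite /e1; field; rewrite gt_eqF.
have [L L0 hL] := hmod _ e10.
pose C := M + L * T + 1; have C0 : 0 < C by rewrite ltr_wpDl// addr_ge0// mulr_ge0.
pose eta := e / (2 * C); have eta0 : 0 < eta by rewrite divr_gt0// mulr_gt0.
pose K := C * (1 + 2 * T) / eta; have K0 : 0 < K.
  by rewrite divr_gt0// mulr_gt0//; lra.
pose d := Num.min 1 (Num.min (e / (2 * K)) (e / (4 * (L * T + 1)))).
have LT : 0 <= L * T by rewrite mulr_ge0.
have d0 : 0 < d.
  rewrite !lt_min ltr01/=; apply/andP; split; apply: divr_gt0 => //.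
    exact: mulr_gt0.
  lra.
have d1 : d <= 1 by rewrite ge_min lexx.
have d2 : d * K <= e / 2.
  have : d <= e / (2 * K) by rewrite !ge_min lexx orbT.
  by rewrite ler_pdivlMr; lra.
have d3 : d * (L * T + 1) <= e / 4.
  have : d <= e / (4 * (L * T + 1)) by rewrite !ge_min lexx !orbT.
  by rewrite ler_pdivlMr; lra.
have Q r b s : 0 <= s <= T -> `|r| <= d -> b <= 2 * T * d ->
    (M + L * s) * qbound eta r b <= e / 2.
  move=> /andP[s0 sT] rd bd.
  have r2 : r ^+ 2 <= d.
    rewrite -(real_normK (num_real r)) expr2.
    by have := normr_ge0 r; nra.
  have : qbound eta r b <= (eta + d * (1 + 2 * T) / eta) / 2.
    rewrite /qbound ler_pM2r// lerD2l ler_pM2r ?invr_gt0//; lra.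
  set q := qbound _ _ _ => qle.
  have q' : (eta + d * (1 + 2 * T) / eta) / 2 * C = e / 4 + d * K / 2.
    by rewrite /K {1}/eta; field; rewrite !gt_eqF.
  have Cs : M + L * s <= C by rewrite /C; have : L * s <= L * T; [rewrite ler_wpM2l|lra].
  have Ms : 0 <= M + L * s by rewrite addr_ge0// mulr_ge0.
  have p0 : 0 <= (eta + d * (1 + 2 * T) / eta) / 2.
    apply: divr_ge0 => //; apply: addr_ge0; first exact: ltW.
    by apply: divr_ge0; [apply: mulr_ge0; lra|lra].
  apply: (@le_trans _ _ ((M + L * s) * ((eta + d * (1 + 2 * T) / eta) / 2))).
    by rewrite ler_wpM2l.
  apply: (@le_trans _ _ (C * ((eta + d * (1 + 2 * T) / eta) / 2))).
    by rewrite ler_wpM2r.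
  rewrite mulrC q'; lra.
have pos (n : nat) (l : R) : 0 < l -> 0 <= n%:R * l by move=> l0; rewrite mulr_ge0// ltW.
exists d => //; split.
  move=> l m i j /andP[l0 ld] /andP[m0 md] iT jT ijd.
  have H := euler_compare mA L0 (ltW e10) hL Axy hM eta0 l0 m0 iT jT.
  apply: le_trans H _; have := pos i l l0; have := pos j m m0.
  set s := i%:R * l in iT ijd *; set r := j%:R * m in jT ijd * => r0 s0.
  have sl : s * l <= T * d by rewrite ler_pM// ltW.
  have rm : r * m <= T * d by rewrite ler_pM// ltW.
  have := @Q (s - r) (s * l + r * m) s; rewrite s0 iT => /(_ isT ijd) H.
  have {}H := H _; have {}H : (M + L * s) * qbound eta (s - r) (s * l + r * m) <= e / 2.
    by apply: H; lra.
  have : (L * l + e1) * s <= (L * d + e1) * T.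
    apply: ler_pM => //; first by apply: addr_ge0; [apply: mulr_ge0; lra|lra].
    by rewrite lerD2r ler_wpM2l.
  lra.
move=> l i phi /andP[l0 ld] iT prof.
have iT' : i%:R * l <= T by rewrite iT.
have tT : 0 <= T <= T by rewrite T0' lexx.
have := profile_euler_le mA T0 fg igh prof L0 (ltW e10) hL Axy hM eta0 l0 iT' tT.
rewrite iT subrr.
have TT : 0 <= T <= T by rewrite T0' lexx.
have := @Q 0 (l * T) T TT; rewrite normr0 => /(_ (ltW d0)) H.
have {}H := H _; have {}H : (M + L * T) * qbound eta 0 (l * T) <= e / 2.
  apply: H; have : l * T <= d * T by rewrite ler_wpM2r.
  by have : 0 <= d * T by [rewrite mulr_ge0// ltW]; lra.
lra.
Qed.

(** The factor [3] leaves room for one mesh on either side when two times at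
    distance at most one mesh are replaced by grid points. *)
Definition good_scheme e (h : R -> X) x n : Prop :=
  [/\ (0 < n)%N, op_domain A x, `|u0 - x| <= e,
    (forall m, (n <= m)%N -> forcing_error h m <= 2 * e) &
    (exists2 d, 3 * mesh n <= d & forall m p i j, (n <= m)%N -> (n <= p)%N ->
       (i <= m)%N -> (j <= p)%N -> `|i%:R * mesh m - j%:R * mesh p| <= d ->
       `|euler A (mesh m) h x i - euler A (mesh p) h x j| <= e) /\
    (forall phi, distance_profile A g u0 T phi ->
       phi T (euler A (mesh n) h x n) <= 3 * e)].

Lemma good_scheme_exists e : 0 < e -> exists h x n, good_scheme e h x n /\ mesh n <= e.
Proof.
move=> e0.
have [x [[y Axy] xu0]] := Du0 (nbhsx_ballx u0 e e0).
have [h ch [igh gh]] := forcing_continuous_approx T fg e0.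
have [d1 d10 H1] := forcing_error_le ch e0 igh.
have [d2 d20 [H2 H3]] := euler_cauchy_profile ch Axy igh e0.
have d0 : 0 < Num.min d1 (Num.min (d2 / 3) e).
  by rewrite !lt_min d10 e0 andbT divr_gt0.
have [n n0 nd] := mesh_small d0.
have nm m : (n <= m)%N -> (0 < m)%N /\ mesh m <= Num.min d1 (Num.min (d2 / 3) e).
  move=> nm; split; first exact: leq_trans nm.
  exact: le_trans (mesh_decr n0 nm) nd.
exists h, x, n; split; last by move: nd; rewrite !le_min => /and3P[].
have xe : `|u0 - x| <= e by rewrite -ball_normE /= in xu0; exact: ltW.
split=> //; first by exists y.
  move=> m /nm[m0]; rewrite !le_min => /and3P[md1 _ _].
  by apply: le_trans (H1 _ m0 md1) _; lra.
have step m : (n <= m)%N -> 0 < mesh m <= d2.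
  move=> /nm[m0]; rewrite !le_min => /and3P[_ md _].
  by rewrite mesh_gt0//=; lra.
split.
  exists d2; first by move: nd; rewrite !le_min => /and3P[]; lra.
  move=> m p i j n_m n_p im jp ij; apply: H2 => //; try exact: step.
    exact: mesh_le.
  exact: mesh_le.
move=> phi prof; apply: le_trans (H3 _ _ _ (step n (leqnn n)) (mulr_mesh n0) prof) _.
lra.
Qed.

(** Both schemes are compared with their refinements on a common grid, where
    [euler_stable_mesh] applies. *)
Lemma good_scheme_close e e' h h' x x' n n' t : 0 <= t <= T ->
  good_scheme e h x n -> good_scheme e' h' x' n' ->
  `|euler A (mesh n) h x (grid_index n t) - euler A (mesh n') h' x' (grid_index n' t)|
    <= 4 * (e + e').
Proof.
move=> tT [n0 _ xe err [[d nd H] _]] [n'0 _ xe' err' [[d' nd' H'] _]].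
pose m := maxn n n'; have nm : (n <= m)%N by exact: leq_maxl.
have n'm : (n' <= m)%N by exact: leq_maxr.
have m0 : (0 < m)%N by exact: leq_trans nm.
have [in_ /andP[i1 i2]] := grid_indexP n0 tT.
have [in'_ /andP[i1' i2']] := grid_indexP n'0 tT.
have [im_ /andP[im1 im2]] := grid_indexP m0 tT.
have mn := mesh_decr n0 nm; have mn' := mesh_decr n'0 n'm.
have A1 : `|euler A (mesh n) h x (grid_index n t) -
            euler A (mesh m) h x (grid_index m t)| <= e.
  apply: H => //; rewrite ler_norml; apply/andP; split; lra.
have A2 : `|euler A (mesh m) h' x' (grid_index m t) -
            euler A (mesh n') h' x' (grid_index n' t)| <= e'.
  apply: H' => //; rewrite ler_norml; apply/andP; split; lra.
have A3 := euler_stable_mesh h h' x x' im_.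
have E1 := err _ nm; have E2 := err' _ n'm.
have := ler_distD u0 x x'; rewrite [`|x - u0|]distrC => A4.
set a := euler A (mesh n) h x _ in A1 *.
set b := euler A (mesh m) h x _ in A1 A3.
set b' := euler A (mesh m) h' x' _ in A2 A3.
set a' := euler A (mesh n') h' x' _ in A2 *.
have := ler_distD b a a'; have := ler_distD b' b a'; lra.
Qed.

(** The limit of the schemes, together with the schemes that witness at once
    that it is a mild solution and that every profile at time [T] is
    concentrated at [u T]. *)
Theorem euler_limit : exists u : R -> X, {within `[0, T], continuous u} /\
  forall s, 0 < s -> exists h x n,
    [/\ (0 < n)%N, mesh n <= s, op_domain A x, `|x - u0| <= s &
       [/\ forcing_error h n <= s,
         (forall i t, (i <= n)%N -> 0 <= t <= T -> `|t - i%:R * mesh n| <= mesh n ->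
            `|u t - euler A (mesh n) h x i| <= s) &
         forall phi, distance_profile A g u0 T phi ->
            phi T (euler A (mesh n) h x n) <= s]].
Proof.
have ek k : 0 < k.+1%:R^-1 :> R by rewrite invr_gt0.
have /choice[p pP] : forall k : nat, exists p : (R -> X) * X * nat,
    good_scheme k.+1%:R^-1 p.1.1 p.1.2 p.2 /\ mesh p.2 <= k.+1%:R^-1.
  by move=> k; have [h [x [n H]]] := good_scheme_exists (ek k); exists (h, x, n).
pose v k t := euler A (mesh (p k).2) (p k).1.1 (p k).1.2 (grid_index (p k).2 t).
have /choice[u uP] : forall t, exists l : X, 0 <= t <= T ->
    forall k, `|l - v k t| <= 2 * 4 * k.+1%:R^-1.
  move=> t; have [tT|_] := boolP (0 <= t <= T); last by exists 0.
  have [|k m|l lH] := @harmonic_cauchy_limit R X (v ^~ t) 4; first by [].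
    exact: good_scheme_close tT (pP k).1 (pP m).1.
  by exists l.
have vclose k : exists2 d, 3 * mesh (p k).2 <= d & forall i t, (i <= (p k).2)%N ->
    0 <= t <= T -> `|t - i%:R * mesh (p k).2| <= d - mesh (p k).2 ->
    `|v k t - euler A (mesh (p k).2) (p k).1.1 (p k).1.2 i| <= k.+1%:R^-1.
  have [[n0 _ _ _ [[d nd H] _]] _] := pP k; exists d => // i t i_n tT ti.
  have [jn /andP[j1 j2]] := grid_indexP n0 tT.
  apply: H => //; have := mesh_gt0 n0; move: ti.
  rewrite !ler_norml => /andP[? ?] ?; apply/andP; split; lra.
exists u; split.
  apply/within_continuous_itvP => r rT e e0.
  have e20 : 0 < e / 20 by lra.
  have [k _ /(_ k (leqnn k))/ltW/= ke] := near_infty_natSinv_lt (PosNum e20).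
  have [d nd H] := vclose k; have n0 : (0 < (p k).2)%N by have [[]] := pP k.
  have l0 := mesh_gt0 n0; have [jn /andP[j1 j2]] := grid_indexP n0 rT.
  exists (mesh (p k).2) => // s sT sr.
  have h1 := uP s sT k; have h2 := uP r rT k.
  have h3 : `|v k s - v k r| <= k.+1%:R^-1.
    apply: H => //; move: sr; rewrite !ler_norml => /andP[? ?].
    by apply/andP; split; lra.
  have := ler_distD (v k s) (u s) (u r); have := ler_distD (v k r) (v k s) (u r).
  by rewrite [`|v k r - u r|]distrC; move: (k.+1%:R^-1) h1 h2 h3 ke => z; lra.
move=> s s0; have s20 : 0 < s / 20 by lra.
have [k _ /(_ k (leqnn k))/ltW/= ks] := near_infty_natSinv_lt (PosNum s20).
have [[n0 Dx xe err [_ prof]] nk] := pP k; have [d nd H] := vclose k.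
exists (p k).1.1, (p k).1.2, (p k).2; split => //.
- apply: le_trans nk (le_trans ks _); lra.
- rewrite distrC; apply: le_trans xe (le_trans ks _); lra.
have l0 := mesh_gt0 n0; move: (k.+1%:R^-1) ks err prof H (fun t tT => uP t tT k) => z.
move=> ks err prof H uP'.
split.
- by have := err _ (leqnn _); lra.
- move=> i t i_n tT ti; have := uP' t tT; have := H i t i_n tT.
  have -> : `|t - i%:R * mesh (p k).2| <= d - mesh (p k).2 by lra.
  move=> /(_ isT); set a := euler _ _ _ _ _.
  have := ler_distD (v k t) (u t) a; lra.
- by move=> phi /prof; lra.
Qed.

End EulerConvergence.

(** * Mild and integral solutions *)

Section MildIntegral.
Context {R : realType} {X : completeNormedModType R}.
Variable A : set (X * X).
Hypothesis mA : m_accretive A.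
Context (f g : R -> X) (u0 : X) (T : R).
Hypothesis fg : forcing g.
Local Notation leb := (@lebesgue_measure R).
Hypothesis fgE : {ae leb, forall t, 0 < t -> t <= T -> f t = g t}.

(** Accretivity applied with the parameter [l * d / (l + d)], for which the
    implicit step of length [d] from [p0] to [p] leaves the increment [l] of the
    difference quotient free. *)
Lemma accretive_dquot p p0 x z c d l : 0 < d -> 0 < l ->
  A (p, c - d^-1 *: (p - p0)) -> A (x, z) ->
  `|p - x| - `|p0 - x| <= d * dquot (p - x) (c - z) l.
Proof.
move=> d0 l0 Ap Ax; have dl : 0 < d + l by lra.
have m0 : 0 < l * d / (d + l) by rewrite divr_gt0// mulr_gt0.
have := mA.1 _ _ _ _ Ap Ax _ m0; set m := l * d / (d + l) => H.
have : (d + l) * `|p - x| <= d * `|p - x + l *: (c - z)| + l * `|p0 - x|.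
  have -> : d * `|p - x + l *: (c - z)| + l * `|p0 - x| =
      `|d *: (p - x + l *: (c - z))| + `|l *: (p0 - x)|.
    by rewrite !normrZ !gtr0_norm.
  apply: (@le_trans _ _ ((d + l) * `|p - x + m *: (c - d^-1 *: (p - p0) - z)|)).
    by rewrite ler_pM2l.
  rewrite -[X in X * _](gtr0_norm dl) -normrZ.
  have -> : (d + l) *: (p - x + m *: (c - d^-1 *: (p - p0) - z)) =
     d *: (p - x + l *: (c - z)) + l *: (p0 - x).
    by rewrite /m; lincomb R [:: p; p0; x; z; c]; field; rewrite ?gt_eqF.
  exact: ler_normD.
move=> {}H; rewrite /dquot mulrA ler_pdivlMr//; lra.
Qed.

Section WithinContinuous.
Context (w : R -> X).
Hypothesis cw : {within `[0, T], continuous w}.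

Lemma within_measurable_dist c : measurable_fun `]0, T] (fun t => `|w t - c|).
Proof.
apply: (@measurable_funS _ _ _ _ `[0, T]) => //.
  by move=> t /=; rewrite !in_itv/= => /andP[/ltW -> ->].
apply: subspace_continuous_measurable_fun => //.
apply/(@within_continuous_itvP R R^o) => r rT e e0.
have [d d0 H] := (within_continuous_itvP w 0 T).1 cw r rT e e0.
exists d => // s sT sr; apply: le_trans (H s sT sr).
apply: le_trans (ler_dist_dist _ _) _.
by rewrite opprB addrA subrK.
Qed.

Lemma within_measurable_dquot x z l :
  measurable_fun `]0, T] (fun t => dquot (w t - x) (g t - z) l).
Proof.
apply: (@measurable_fun_caratheodory _ (measurableTypeR R) _ _ _ _
  (fun t y => dquot (w t - x) (y - z) l) _ fg.1) => //.
  move=> y.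
  have -> : (fun t => dquot (w t - x) (y - z) l) =
      (fun t => (`|w t - (x - l *: (y - z))| - `|w t - x|) * l^-1).
    by apply/funext => t; rewrite /dquot opprB addrA addrAC.
  apply: measurable_funM => //.
  by apply: measurable_funB; exact: within_measurable_dist.
move=> t _ y; apply: cvgM; last exact: cvg_cst.
apply: cvgB; last exact: cvg_cst; apply: cvg_norm.
apply: cvgD; first exact: cvg_cst.
by apply: cvgZ; [exact: cvg_cst|apply: cvgB; [exact: cvg_id|exact: cvg_cst]].
Qed.

Lemma within_measurable_bracket x z :
  measurable_fun `]0, T] (fun t => bracket (w t - x) (g t - z)).
Proof.
apply: (@measurable_fun_cvg _ _ _ _
  (fun n t => dquot (w t - x) (g t - z) n.+1%:R^-1)).
  by move=> n; exact: within_measurable_dquot.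
by move=> t _; exact: dquot_harmonic_cvg.
Qed.

Lemma within_integrable_dquot x z l : 0 < l ->
  ioc_integrable 0 T (fun t => dquot (w t - x) (g t - z) l).
Proof.
move=> l0; apply: (ioc_le_integrable (within_measurable_dquot x z l)
  _ (forcing_dist_integrable z 0 T fg)) => t _.
by rewrite normr_id ler_norm_dquot.
Qed.

Lemma within_integrable_bracket x z :
  ioc_integrable 0 T (fun t => bracket (w t - x) (g t - z)).
Proof.
apply: (ioc_le_integrable (within_measurable_bracket x z)
  _ (forcing_dist_integrable z 0 T fg)) => t _.
by rewrite normr_id ler_norm_bracket.
Qed.

Lemma integral_bracketE x z s t : 0 <= s -> t <= T ->
  (\int[leb]_(r in `]s, t]) (bracket (w r - x) (f r - z))%:E =
   (ioc_int (fun r => bracket (w r - x) (g r - z)) s t)%:E)%E.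
Proof.
move=> s0 tT; rewrite EFin_ioc_int; last first.
  exact: ioc_integrableS s0 tT (within_integrable_bracket x z).
apply: integral_ae_eq; apply: ae_mono fgE => r fgr /=; rewrite in_itv/=.
by move=> /andP[sr rt]; rewrite fgr//; lra.
Qed.

End WithinContinuous.

Lemma integral_solution_profile w : integral_solution A T f u0 w ->
  distance_profile A g u0 T (fun t x => `|w t - x|).
Proof.
move=> [cw w0 iw]; split=> [x _|x x' c l l0 Ax Dx' s t B /andP[s0 st] tT HB].
  by rewrite w0.
have := iw _ _ Ax s t s0 st tT; rewrite (integral_bracketE cw)// lee_fin.
move/le_trans; apply.
have -> : (t - s) / l * B = (t - s) * (B / l) by ring.
rewrite -ioc_int_cst// -ioc_intD; last 2 first.
  exact: forcing_dist_integrable.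
  exact: ioc_integrable_cst.
apply: le_ioc_int.
- exact: ioc_integrableS s0 tT (within_integrable_bracket cw _ _).
- apply: ioc_integrableD; first exact: forcing_dist_integrable.
  exact: ioc_integrable_cst.
- move=> r rst.
  have -> : g r - (c - l^-1 *: (x - x')) =
     (g r - c) + l^-1 *: ((w r - x') - (w r - x)).
    by lincomb R [:: g r; c; x; x'; w r]; ring.
  apply: le_trans (bracket_le_norm _ _ _ l0) _.
  by rewrite lerD2l ler_pM2r ?invr_gt0// HB.
Qed.

(** Both sides of the inequality are limits along the approximate solutions: one
    sums [accretive_dquot] over the grid, with the increment [l] fixed so that
    the integrand depends continuously on the solution. *)
Lemma mild_dquot_le w x z l s t : mild_solution A T f u0 w -> A (x, z) -> 0 < l ->
  0 <= s -> s <= t -> t <= T ->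
  `|w t - x| - `|w s - x| <= ioc_int (fun r => dquot (w r - x) (g r - z) l) s t.
Proof.
move=> [cw Hw] Axz l0 s0 st tT.
pose Dq r := dquot (w r - x) (g r - z) l.
have iDq : ioc_integrable 0 T Dq by exact: within_integrable_dquot.
have T0 : 0 <= T by lra.
have tt : 0 <= t <= T by apply/andP; split; lra.
have ss : 0 <= s <= T by apply/andP; split; lra.
pose I r := ioc_int Dq 0 r.
have Isplit a b : 0 <= a -> a <= b -> b <= T -> I b = I a + ioc_int Dq a b.
  move=> a0 ab bT; apply: ioc_int_split => //.
  exact: ioc_integrableS (lexx 0) bT iDq.
rewrite -/Dq; have -> : ioc_int Dq s t = I t - I s by rewrite (Isplit s t)// addrC addKr.
apply/ler_addgt0Pr => e e0.
have e8 : 0 < e / 8 by lra.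
have cw' := (within_continuous_itvP w 0 T).1 cw.
have [d1 d10 H1] := ioc_int_cvg T0 iDq tt e8.
have [d2 d20 H2] := ioc_int_cvg T0 iDq ss e8.
have [d3 d30 H3] := cw' t tt _ e8; have [d4 d40 H4] := cw' s ss _ e8.
pose C := 3 + 2 * T / l; have C0 : 0 < C.
  by rewrite ltr_pwDl// divr_ge0 ?mulr_ge0// ltW.
pose sigma := Num.min (Num.min d1 d2) (Num.min (Num.min d3 d4) (e / (4 * C))).
have sg0 : 0 < sigma.
  by rewrite !lt_min d10 d20 d30 d40/= divr_gt0// mulr_gt0.
have [sg1 sg2 sg3 sg4 sgC] : [/\ sigma <= d1, sigma <= d2, sigma <= d3, sigma <= d4 &
    sigma * C <= e / 4].
  have: sigma <= sigma by []; rewrite {2}/sigma !le_min => /andP[/andP[? ?]].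
  move=> /andP[/andP[? ?]]; rewrite ler_pdivlMr; last by rewrite mulr_gt0.
  by move=> ?; split => //; lra.
have [N [ti [gs [v [[t00 tstep tN err] [vs [v0 vstep vsA vs0]] wv]]]]] := Hw _ sg0.
have tmono i j : (i <= j)%N -> (j <= N)%N -> ti i <= ti j.
  elim: j => [|j IH]; first by rewrite leqn0 => /eqP ->.
  rewrite leq_eqVlt => /predU1P[->//|ij] jN.
  by apply: le_trans (IH ij (ltnW jN)) _; have [/ltW] := tstep j jN.
have ti0 i : (i <= N)%N -> 0 <= ti i by move=> iN; rewrite -t00 tmono.
have tiT i : (i <= N)%N -> ti i <= T.
  by move=> iN; have := tmono i N iN (leqnn N); lra.
have last_index r : 0 <= r <= T -> exists k, [/\ (k <= N)%N, ti k <= r,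
    r - ti k <= sigma & forall j, (j <= N)%N -> ti j <= r -> (j <= k)%N].
  move=> /andP[r0 rT].
  have ex : exists k, (k <= N)%N && (ti k <= r) by exists 0%N; rewrite t00 r0.
  have bd k : (k <= N)%N && (ti k <= r) -> (k <= N)%N by move=> /andP[].
  case: (ex_maxnP ex bd) => k /andP[kN kr] kmax; exists k; split => //.
    move: kN; rewrite leq_eqVlt => /predU1P[kN|kN]; first by rewrite kN; lra.
    have [_ step] := tstep k kN.
    have : r < ti k.+1.
      rewrite ltNge; apply/negP => H; have := kmax k.+1.
      by rewrite kN H ltnn => /(_ isT).
    lra.
  by move=> j jN jr; apply: kmax; rewrite jN.
have [k [kN kt tk kmax]] := last_index t tt.
have [j [jN js sj _]] := last_index s ss.
have jk : (j <= k)%N by apply: kmax => //; lra.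
have vsv i : (i <= N)%N -> `|w (ti i) - vs i| <= sigma.
  move=> iN; have <- : v (ti i) = vs i.
    by case: i iN => // i iN; apply: vstep => //; have [] := tstep i iN.
  by apply: wv; [rewrite t00 ti0|exact: tmono].
pose E i := ioc_int (fun r => `|g r - gs i.+1|) (ti i) (ti i.+1).
have E0 i : 0 <= E i by exact: ioc_int_ge0.
have sumE : \sum_(i < N) E i <= sigma.
  rewrite -lee_fin -sumEFin; apply: le_trans err.
  rewrite le_eqVlt; apply/orP; left; apply/eqP; apply: eq_bigr => i _.
  rewrite EFin_ioc_int; last exact: forcing_dist_integrable.
  apply: integral_ae_eq; apply: ae_mono fgE => r fgr /=; rewrite in_itv/=.
  move=> /andP[sr rt]; rewrite fgr//.
    by apply: le_lt_trans sr; exact/ti0/ltnW.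
  by apply: le_trans rt _; exact: tiT.
have step i : (i < N)%N -> `|vs i.+1 - x| - `|vs i - x| <=
    (I (ti i.+1) - I (ti i)) + (ti i.+1 - ti i) * (2 * sigma / l) + E i.
  move=> iN; have [tlt _] := tstep i iN.
  have d0 : 0 < ti i.+1 - ti i by rewrite subr_gt0.
  have [y Ay yE] := vsA i iN.
  have Ap : A (vs i.+1, gs i.+1 - (ti i.+1 - ti i)^-1 *: (vs i.+1 - vs i)).
    by rewrite -yE addrAC subrr add0r.
  apply: le_trans (accretive_dquot d0 l0 Ap Axz) _.
  rewrite (Isplit _ _ (ti0 _ (ltnW iN)) (ltW tlt) (tiT _ iN)) [I _ + _]addrC addrK.
  have iD : ioc_integrable (ti i) (ti i.+1) Dq.
    exact: ioc_integrableS (ti0 _ (ltnW iN)) (tiT _ iN) iDq.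
  have ic := ioc_integrable_cst (ti i) (ti i.+1) (2 * sigma / l).
  have ig := forcing_dist_integrable (gs i.+1) (ti i) (ti i.+1) fg.
  have iDc := ioc_integrableD iD ic.
  rewrite -!(ioc_int_cst _ (ltW tlt)) -ioc_intD// -ioc_intD//.
  apply: le_ioc_int; [exact: ioc_integrable_cst|exact: ioc_integrableD|].
  move=> r /andP[ir ri].
  have wr : `|w r - vs i.+1| <= sigma.
    rewrite -(vstep i iN r ir ri); apply: wv.
      by rewrite t00; apply: le_trans (ti0 i (ltnW iN)) (ltW ir).
    by apply: le_trans ri (tmono _ _ iN (leqnn N)).
  apply: le_trans (ler_dquotB _ (w r - x) _ (g r - z) l0) _.
  have -> : vs i.+1 - x - (w r - x) = vs i.+1 - w r by rewrite opprB addrA subrK.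
  have -> : gs i.+1 - z - (g r - z) = gs i.+1 - g r by rewrite opprB addrA subrK.
  rewrite [`|gs _ - _|]distrC lerD2r lerD2l ler_pM2r ?invr_gt0// ler_pM2l//.
  by rewrite distrC.
(* By [step], [`|vs i - x| - S i] does not increase with [i]. *)
pose S i := I (ti i) + ti i * (2 * sigma / l) + \sum_(m < i) E m.
have mono i m : (i <= m)%N -> (m <= N)%N ->
    `|vs m - x| - S m <= `|vs i - x| - S i.
  elim: m => [|m IH]; first by rewrite leqn0 => /eqP ->.
  rewrite leq_eqVlt => /predU1P[->//|im] mN.
  apply: le_trans (IH im (ltnW mN)); have := step m mN.
  rewrite /S big_ord_recr /=; lra.
have sumle m : (m <= N)%N -> \sum_(i < m) E i <= sigma.
  move=> mN; apply: le_trans sumE; rewrite -(subnKC mN) big_split_ord /=.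
  by rewrite lerDl sumr_ge0.
have := mono j k jk kN; rewrite /S.
have := sumle k kN; have : 0 <= \sum_(m < j) E m by rewrite sumr_ge0.
have := ti0 j jN; have := tiT k kN; have := vsv j jN; have := vsv k kN.
have tkT : 0 <= ti k <= T by rewrite ti0//= tiT.
have tjT : 0 <= ti j <= T by rewrite ti0//= tiT.
have nk : `|ti k - t| <= sigma by rewrite ler0_norm; lra.
have nj : `|ti j - s| <= sigma by rewrite ler0_norm; lra.
have := H1 _ tkT (le_trans nk sg1); have := H2 _ tjT (le_trans nj sg2).
rewrite -![ioc_int _ _ _]/(I _) !ler_norml => /andP[I1 I2] /andP[I3 I4].
have := H3 _ tkT (le_trans nk sg3); have := H4 _ tjT (le_trans nj sg4).
have D1 := ler_distD (w (ti k)) (w t) x; have D2 := ler_distD (vs k) (w (ti k)) x.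
have D4 := ler_distD (w (ti j)) (vs j) x; have D5 := ler_distD (w s) (w (ti j)) x.
rewrite [`|w (ti k) - w t|]distrC => W2 W1 V1 V2 tk' tj' Ej Ek H.
rewrite [`|vs j - w (ti j)|]distrC in D4.
have tjk : ti k * (2 * sigma / l) - ti j * (2 * sigma / l) <= sigma * (2 * T / l).
  have -> : sigma * (2 * T / l) = T * (2 * sigma / l) by ring.
  rewrite -mulrBl ler_wpM2r//; last lra.
  by rewrite divr_ge0 ?mulr_ge0// ltW.
have : sigma * (2 * T / l) = sigma * C - 3 * sigma by rewrite /C; ring.
lra.
Qed.

Lemma mild_integral_solution w : mild_solution A T f u0 w ->
  integral_solution A T f u0 w.
Proof.
move=> mw; have [cw Hw] := mw; split => //.
  apply/eqP; rewrite -subr_eq0 -normr_le0; apply/ler_addgt0Pr => e e0.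
  have e2 : 0 < e / 2 by lra.
  have [N [ti [gs [v [[t00 tstep _ _] [vs [v0 _ _ vs0]] wv]]]]] := Hw _ e2.
  have tN : ti 0%N <= ti N.
    have H k : (k <= N)%N -> ti 0%N <= ti k.
      elim: k => // k IH kN; apply: le_trans (IH (ltnW kN)) _.
      by have [/ltW] := tstep k kN.
    exact: H.
  have := wv (ti 0%N) (lexx _) tN; rewrite v0 t00.
  by have := ler_distD (vs 0%N) (w 0) u0; lra.
move=> x z Axz s t s0 st tT.
rewrite (integral_bracketE cw)// EFin_ioc_int; last first.
  exact: ioc_integrableS s0 tT (within_integrable_bracket cw x z).
have sub : `]s, t]%classic `<=` `]0, T]%classic.
  by move=> r /=; rewrite !in_itv/= => /andP[? ?]; apply/andP; split; lra.
have [] := @dominated_convergence _ (measurableTypeR R) R leb `]s, t] _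
    (fun n r => (dquot (w r - x) (g r - z) n.+1%:R^-1)%:E)
    (fun r => (bracket (w r - x) (g r - z))%:E) (fun r => (`|g r - z|)%:E) => //.
- move=> n; apply/measurable_EFinP; apply: measurable_funS sub _ => //.
  exact: within_measurable_dquot.
- apply/measurable_EFinP; apply: measurable_funS sub _ => //.
  exact: within_measurable_bracket.
- apply: aeW => r _; apply: cvg_EFin; first exact: nearW.
  exact: dquot_harmonic_cvg.
- exact: (forcing_dist_integrable z s t fg).
- by apply: aeW => r n _ /=; rewrite lee_fin ler_norm_dquot.
move=> _ _ cI; rewrite -(cvg_lim _ cI)//; apply: lime_ge; first exact: cvgP cI.
  apply: nearW => n; have n0 : 0 < n.+1%:R^-1 :> R by rewrite invr_gt0.
  have := mild_dquot_le mw Axz n0 s0 st tT; rewrite -lee_fin EFin_ioc_int//.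
  exact: ioc_integrableS s0 tT (within_integrable_dquot cw x z n0).
Qed.


Lemma distance_profile_restrict t phi : t <= T ->
  distance_profile A g u0 T phi -> distance_profile A g u0 t phi.
Proof.
move=> tT [H1 H2]; split=> // x x' c l l0 Ax Dx' s r B sr rt.
exact: H2 (le_trans rt tT).
Qed.

End MildIntegral.

Section WellPosedness.
Context {R : realType} {X : completeNormedModType R}.
Variable A : set (X * X).
Hypothesis mA : m_accretive A.
Context (f g : R -> X) (u0 : X) (T : R).
Hypothesis T0 : 0 < T.
Hypothesis fg : forcing g.
Hypothesis Du0 : closure (op_domain A) u0.
Local Notation leb := (@lebesgue_measure R).
Hypothesis fgE : {ae leb, forall t, 0 < t -> t <= T -> f t = g t}.

Lemma mild_solution_exists : exists w, mild_solution A T f u0 w.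
Proof.
have [w [cw Hw]] := euler_limit mA T0 fg Du0.
exists w; split=> // s s0.
have [h [x [n [n0 ms Dx xu0 [err close _]]]]] := Hw s s0.
have l0 := mesh_gt0 T0 n0.
have stepE i : i.+1%:R * mesh T n - i%:R * mesh T n = mesh T n.
  by rewrite -natr1 mulrDl mul1r addrC addKr.
exists n, (fun i => i%:R * mesh T n), (fun i => h (i%:R * mesh T n)).
exists (fun t => euler A (mesh T n) h x (grid_index T n t)); split.
- split; first by rewrite mul0r.
  + by move=> i _; rewrite stepE -subr_gt0 stepE.
  + by rewrite mulr_mesh// subrr lexx ltW.
  + have -> : (\sum_(i < n) \int[leb]_(t in `](i%:R * mesh T n)%R, (i.+1%:R * mesh T n)%R])
        (`|f t - h (i.+1%:R * mesh T n)|)%:E)%E = (forcing_error g T h n)%:E.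
      rewrite /forcing_error -sumEFin; apply: eq_bigr => i _.
      rewrite EFin_ioc_int; last exact: forcing_dist_integrable.
      apply: integral_ae_eq; apply: ae_mono fgE => r fgr /=; rewrite in_itv/=.
      move=> /andP[ir ri]; rewrite fgr//.
        by apply: le_lt_trans ir; rewrite mulr_ge0// ltW.
      by apply: le_trans ri _; exact: mesh_le.
    by rewrite lee_fin.
- exists (euler A (mesh T n) h x); split => //.
  + by rewrite mul0r grid_index0.
  + by move=> i iN t it ti; rewrite (grid_index_eq T0 n0 (i := i)) ?it.
  + move=> i iN; exists (h (i.+1%:R * mesh T n) -
      (mesh T n)^-1 *: (euler A (mesh T n) h x i.+1 - euler A (mesh T n) h x i)).
      exact: euler_graph.
    by rewrite stepE addrC subrK.
- move=> t; rewrite mul0r mulr_mesh// => t0 tT.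
  have tT' : 0 <= t <= T by rewrite t0.
  have [i_n /andP[H1 H2]] := grid_indexP T0 n0 tT'.
  apply: close => //; rewrite ler_norml; apply/andP; split; lra.
Qed.

(** All solutions that have a distance profile thus share their value at the
    final time, whatever the final time is. *)
Lemma profile_endpoint : exists w : X, forall s, 0 < s -> exists x,
  [/\ op_domain A x, `|w - x| <= s &
    forall phi, distance_profile A g u0 T phi -> phi T x <= s].
Proof.
have [w [_ Hw]] := euler_limit mA T0 fg Du0.
exists (w T) => s s0; have [h [x [n [n0 ms Dx xu0 [_ close prof]]]]] := Hw s s0.
exists (euler A (mesh T n) h x n); split => //.
  by apply: euler_domain => //; exact: mesh_gt0.
apply: close => //; first by rewrite (ltW T0) lexx.
by rewrite mulr_mesh// subrr normr0; exact/ltW/mesh_gt0.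
Qed.

End WellPosedness.

Section Uniqueness.
Context {R : realType} {X : completeNormedModType R}.
Variable A : set (X * X).
Hypothesis mA : m_accretive A.
Context (f g : R -> X) (u0 : X) (T : R).
Hypothesis fg : forcing g.
Hypothesis Du0 : closure (op_domain A) u0.
Local Notation leb := (@lebesgue_measure R).
Hypothesis fgE : {ae leb, forall t, 0 < t -> t <= T -> f t = g t}.

(** At each time [t] the endpoint theorem is applied with horizon [t]. *)
Lemma integral_solution_unique w w' : integral_solution A T f u0 w ->
  integral_solution A T f u0 w' -> forall t, 0 <= t -> t <= T -> w' t = w t.
Proof.
move=> iw iw' t; rewrite le_eqVlt => /predU1P[<-|t0] tT.
  by have [_ -> _] := iw; have [_ -> _] := iw'.
have [p Hp] := profile_endpoint mA t0 fg Du0.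
have E v : integral_solution A T f u0 v -> v t = p.
  move=> /(integral_solution_profile fg fgE)/(distance_profile_restrict tT) Pv.
  apply/eqP; rewrite -subr_eq0 -normr_le0; apply/ler_addgt0Pr => e e0.
  have e2 : 0 < e / 2 by lra.
  have [x [_ px /(_ _ Pv) vx]] := Hp _ e2.
  by have := ler_distD x (v t) p; rewrite [`|x - p|]distrC; lra.
by rewrite !E.
Qed.

Lemma unique_integral_mild_solution_exists : 0 < T ->
  exists w, unique_integral_mild_solution A T f u0 w.
Proof.
move=> T0; have [w mw] := mild_solution_exists mA T0 fg Du0 fgE.
have iw := mild_integral_solution mA fg fgE mw.
exists w; split => // w' [/(mild_integral_solution mA fg fgE)|] iw';
  exact: integral_solution_unique.
Qed.

End Uniqueness.

(** * Sections of null sets in a product *)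

Section Sections.
Context {d1 d2 : measure_display} {T1 : measurableType d1}
  {T2 : measurableType d2} {R : realType}.
Variables (m1 : {sigma_finite_measure set T1 -> \bar R})
  (m2 : {sigma_finite_measure set T2 -> \bar R}).

Let indic_measurable (N : set (T1 * T2)) : measurable N ->
  measurable_fun setT (EFin \o (\1_N : T1 * T2 -> R)).
Proof. by move=> mN; apply/measurable_EFinP. Qed.

Lemma ae_swap (N : set (T1 * T2)) : measurable N ->
  {ae m1, forall x, {ae m2, forall y, ~ N (x, y)}} ->
  {ae m2, forall y, {ae m1, forall x, ~ N (x, y)}}.
Proof.
move=> mN N1; have mI := indic_measurable mN.
have I0 : (\int[m1]_x \int[m2]_y (\1_N (x, y))%:E = 0)%E.
  rewrite (integral_ae_eq (f' := cst 0%E)) ?integral0//.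
  apply: ae_mono N1 => x Nx _; rewrite (integral_ae_eq (f' := cst 0%E)) ?integral0//.
  by apply: ae_mono Nx => y Nxy _; rewrite indicE memNset.
have I0N p : (0 <= (EFin \o (\1_N : T1 * T2 -> R)) p)%E by rewrite /= lee_fin.
have := fubini_tonelli (m1 := m1) (m2 := m2) _ mI I0N; rewrite I0 => /esym {}I0.
have mG : measurable_fun setT (fun y => \int[m1]_x (EFin \o (\1_N : T1 * T2 -> R)) (x, y))%E.
  exact: (measurable_fun_fubini_tonelli_G _ mI I0N).
have := (ae_eq_integral_abs m2 measurableT mG).1.
under eq_integral => ? _.
  by rewrite gee0_abs; [over|apply: integral_ge0 => ? _; rewrite /= lee_fin].
move=> /(_ I0); apply: ae_mono => y /(_ I) /= Iy.
have mGy : measurable_fun setT (fun x => (EFin \o (\1_N : T1 * T2 -> R)) (x, y)).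
  by apply: measurableT_comp => //; exact: measurable_pair2.
have := (ae_eq_integral_abs m1 measurableT mGy).1.
under eq_integral => ? _ do rewrite gee0_abs /= ?lee_fin//.
move=> /(_ Iy); apply: ae_mono => x /(_ I) /= + Nxy.
by rewrite indicE mem_set// => -[] /eqP; rewrite oner_eq0.
Qed.

Lemma ae_section1 (P : T1 * T2 -> Prop) :
  {ae (m1 \x m2)%E, forall p, P p} -> {ae m1, forall x, {ae m2, forall y, P (x, y)}}.
Proof.
move=> [N [mN N0 subN]].
have mI := indic_measurable mN.
have I0N p : (0 <= (EFin \o (\1_N : T1 * T2 -> R)) p)%E by rewrite /= lee_fin.
have I0 : (\int[m1]_x \int[m2]_y (EFin \o (\1_N : T1 * T2 -> R)) (x, y) = 0)%E.
  have := fubini_tonelli1 (m1 := m1) (m2 := m2) _ mI I0N; rewrite /fubini_F => <-.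
  by rewrite integral_indic// setIT.
have mF : measurable_fun setT (fun x => \int[m2]_y (EFin \o (\1_N : T1 * T2 -> R)) (x, y))%E.
  exact: (measurable_fun_fubini_tonelli_F _ mI I0N).
have := (ae_eq_integral_abs m1 measurableT mF).1.
under eq_integral => ? _.
  by rewrite gee0_abs; [over|apply: integral_ge0 => ? _; rewrite /= lee_fin].
move=> /(_ I0); apply: ae_mono => x /(_ I) /= Ix.
have mFx : measurable_fun setT (fun y => (EFin \o (\1_N : T1 * T2 -> R)) (x, y)).
  by apply: measurableT_comp => //; exact: measurable_pair1.
have := (ae_eq_integral_abs m2 measurableT mFx).1.
under eq_integral => ? _ do rewrite gee0_abs /= ?lee_fin//.
move=> /(_ Ix); apply: ae_mono => y /(_ I) /= Nxy.
apply: contrapT => nP; have : N (x, y) by exact: subN.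
by move=> Nxy'; move: Nxy; rewrite indicE mem_set// => -[] /eqP; rewrite oner_eq0.
Qed.

Lemma ae_section2 (P : T1 * T2 -> Prop) :
  {ae (m1 \x m2)%E, forall p, P p} -> {ae m2, forall y, {ae m1, forall x, P (x, y)}}.
Proof.
move=> [N [mN N0 subN]].
have : {ae (m1 \x m2)%E, forall p, ~ N p} by exists N; split => // p /= /contrapT.
move=> /ae_section1/(ae_swap mN); apply: ae_mono => y; apply: ae_mono => x Nxy.
by apply: contrapT => nP; apply: Nxy; exact: subN.
Qed.

End Sections.

(** * Averages over the unit interval *)

Section UnitMean.
Context {R : realType}.
Local Notation leb := (@lebesgue_measure R).
Implicit Types h k : R -> R.

(** Functions of [alpha] that agree almost everywhere on [(0, 1)] with an
    integrable one: the values of a process need not be measurable in [alpha]. *)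
Definition unit_integrable h : Prop :=
  exists2 h' : R -> R, leb.-integrable `]0, 1[ (EFin \o h') &
    {ae leb, forall a, 0 < a -> a < 1 -> h a = h' a}.

Definition unit_mean h : R := \int[leb]_(a in `]0, 1[) h a.

Lemma unit_mean_ae h k : {ae leb, forall a, 0 < a -> a < 1 -> h a = k a} ->
  unit_mean h = unit_mean k.
Proof.
move=> hk; congr fine; apply: integral_ae_eq; apply: ae_mono hk => a hka /=.
by rewrite in_itv/= => /andP[a0 a1]; rewrite hka.
Qed.

Lemma EFin_unit_mean h : unit_integrable h ->
  ((unit_mean h)%:E = \int[leb]_(a in `]0%R, 1%R[) (h a)%:E)%E.
Proof.
move=> [h' ih' hh']; rewrite /unit_mean /Rintegral.
have -> : (\int[leb]_(a in `]0%R, 1%R[) (h a)%:E =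
    \int[leb]_(a in `]0%R, 1%R[) (h' a)%:E)%E.
  apply: integral_ae_eq; apply: ae_mono hh' => a hha /=.
  by rewrite in_itv/= => /andP[a0 a1]; rewrite hha.
by rewrite fineK//; exact: integrable_fin_num.
Qed.

Lemma le_unit_mean h k : unit_integrable h -> unit_integrable k ->
  {ae leb, forall a, 0 < a -> a < 1 -> h a <= k a} -> unit_mean h <= unit_mean k.
Proof.
move=> ih ik hk; rewrite -lee_fin !EFin_unit_mean//; apply: le_integral_ae.
apply: ae_mono hk => a hka /=.
by rewrite in_itv/= => /andP[a0 a1]; rewrite lee_fin hka.
Qed.

Lemma lebesgue_measure_unit : leb `]0 : R, 1[%classic = 1%E.
Proof. by rewrite lebesgue_measure_itv/= lte_fin ltr01 oppr0 adde0. Qed.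

Lemma unit_integrable_cst (c : R) : unit_integrable (fun=> c).
Proof.
exists (fun=> c); last by apply: aeW.
apply: measurable_bounded_integrable => //.
  by have := ltry (1 : R); rewrite -lebesgue_measure_unit.
exists `|c|; split; rewrite ?num_real// => M cM x _; exact: ltW.
Qed.

Lemma unit_mean_cst (c : R) : unit_mean (fun=> c) = c.
Proof. by rewrite /unit_mean Rintegral_cst//= lebesgue_measure_unit mulr1. Qed.

Lemma unit_integrableD h k : unit_integrable h -> unit_integrable k ->
  unit_integrable (fun a => h a + k a).
Proof.
move=> [h' ih hh'] [k' ik kk']; exists (fun a => h' a + k' a).
  by have := integrableD _ ih ik; apply.
by apply: ae_mono2 hh' kk' => a ha ka a0 a1; rewrite ha// ka.
Qed.

Lemma unit_integrableZ h (c : R) : unit_integrable h ->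
  unit_integrable (fun a => c * h a).
Proof.
move=> [h' ih hh']; exists (fun a => c * h' a).
  by have := integrableZl _ c ih; apply.
by apply: ae_mono hh' => a ha a0 a1; rewrite ha.
Qed.

Lemma unit_meanD h k : unit_integrable h -> unit_integrable k ->
  unit_mean (fun a => h a + k a) = unit_mean h + unit_mean k.
Proof.
move=> [h' ih hh'] [k' ik kk'].
rewrite (unit_mean_ae hh') (unit_mean_ae kk') -RintegralD//.
by apply: unit_mean_ae; apply: ae_mono2 hh' kk' => a ha ka a0 a1; rewrite ha// ka.
Qed.

Lemma unit_meanZ h (c : R) : unit_integrable h ->
  unit_mean (fun a => c * h a) = c * unit_mean h.
Proof.
move=> [h' ih hh']; rewrite (unit_mean_ae hh') -RintegralZl//.
by apply: unit_mean_ae; apply: ae_mono hh' => a ha a0 a1; rewrite ha.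
Qed.

Lemma unit_integrable_le h h' k : measurable_fun `]0 : R, 1[ h' ->
  {ae leb, forall a, 0 < a -> a < 1 -> h a = h' a} -> unit_integrable k ->
  {ae leb, forall a, 0 < a -> a < 1 -> `|h' a| <= k a} -> unit_integrable h.
Proof.
move=> mh hh' [k' /integrableP[mk ik] kk'] hk; exists h' => //.
apply/integrableP; split; first exact/measurable_EFinP.
apply: le_lt_trans ik; apply: le_integral_ae.
apply: ae_mono2 kk' hk => a ka ha /=; rewrite in_itv/= => /andP[a0 a1].
by rewrite lee_fin (le_trans (ha a0 a1))// ka// ler_norm.
Qed.

Lemma bochner_unit_integrable h : @bochner_L1 R _ _ R^o leb `]0, 1[ h ->
  unit_integrable h.
Proof.
move=> [sh ih]; have [|h' [sh' _ hh']] := strongly_measurable_representative _ sh => //.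
have mh' : measurable_fun [set: measurableTypeR R] h'.
  have := @measurable_fun_limit_simple _ (measurableTypeR R) R R^o h' idfun sh'.
  by apply => y; exact: cvg_id.
exists h'; last first.
  by apply: ae_mono hh' => a ha a0 a1; apply: ha; rewrite /= in_itv/= a0.
apply/integrableP; split.
  by apply/measurable_EFinP; exact: measurable_funS mh'.
apply: le_lt_trans ih; apply: le_integral_ae; apply: ae_mono hh' => a ha aD.
by rewrite /= ha.
Qed.

Lemma ae_exists_small (P : R -> Prop) (d : R) : {ae leb, forall t, P t} -> 0 < d ->
  exists2 t, 0 < t < d & P t.
Proof.
move=> [N [mN N0 subN]] d0; apply: contrapT => H.
have : (leb `]0%R, d[%classic <= leb N)%E.
  apply: le_measure; rewrite ?inE//.
  move=> t /=; rewrite in_itv/= => td; apply: subN => Pt; apply: H.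
  by exists t.
rewrite N0 lebesgue_measure_itv/= lte_fin d0 oppr0 adde0 lee_fin.
by rewrite leNgt d0.
Qed.

End UnitMean.

Section Representative.
Context {R : realType} {X : normedModType R}.
Local Notation leb := (@lebesgue_measure R).
Local Notation RR := (measurableTypeR R * measurableTypeR R)%type.

Lemma process_representative (T : R) (v : R -> R -> X) : process_measurable T v ->
  exists v' : RR -> X, [/\ limit_simple v',
   {ae leb, forall t, {ae leb, forall a, 0 < t -> t <= T -> 0 < a -> a < 1 ->
      v t a = v' (t, a)}} &
   {ae leb, forall a, {ae leb, forall t, 0 < t -> t <= T -> 0 < a -> a < 1 ->
      v t a = v' (t, a)}}].
Proof.
move=> mv; have mD : measurable (`]0, T]%classic `*` `]0, 1[%classic : set RR).
  exact: measurableX.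
have [v' [sv' _ vv']] := strongly_measurable_representative mD mv.
have vv : {ae (leb \x leb)%E, forall p : RR, 0 < p.1 -> p.1 <= T -> 0 < p.2 ->
    p.2 < 1 -> v p.1 p.2 = v' p}.
  apply: ae_mono vv' => -[t a] H t0 tT a0 a1; apply: H.
  by split; rewrite /= in_itv/= ?t0 ?a0.
by exists v'; split => //; [exact: ae_section1 vv|exact: ae_section2 vv].
Qed.

Lemma measurable_process_dist (v' : RR -> X) (c : X) (t : R) : limit_simple v' ->
  measurable_fun [set: measurableTypeR R] (fun a => `|v' (t, a) - c|).
Proof.
move=> sv'.
have mv := measurable_fun_limit_simple (F := fun y => `|y - c|) sv' (@continuous_dist _ _ c).
exact: measurableT_comp mv (measurable_pair1 t).
Qed.

End Representative.

(** * Integral-process solutions *)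

Section ProcessProfile.
Context {R : realType} {X : completeNormedModType R}.
Variable A : set (X * X).
Context (f g : R -> X) (u0 : X) (T : R) (v : R -> R -> X).
Local Notation leb := (@lebesgue_measure R).
Local Notation RR := (measurableTypeR R * measurableTypeR R)%type.
Hypothesis T0 : 0 < T.
Hypothesis fg : forcing g.
Hypothesis fgE : {ae leb, forall t, 0 < t -> t <= T -> f t = g t}.
Hypothesis ips : integral_process_solution A T f u0 v.

Local Notation dist_mean t x := (unit_mean (fun a => `|v t a - x|)).

(** Only differences of distances are integrable by definition; the initial
    condition makes the distances themselves integrable at some small times, at
    which the process is moreover measurable in [alpha]. *)
Lemma process_small_times (e d : R) : 0 < e -> 0 < d -> exists2 s, 0 < s < d &
  unit_integrable (fun a => `|v s a - u0|) /\ dist_mean s u0 <= e /\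
  forall x, unit_integrable (fun a => `|v s a - x|).
Proof.
move=> e0 d0; have [mv _ ess] := ips.
have [v' [sv' vv' _]] := process_representative mv.
have [d1 d10 H] := ess e e0.
have d20 : 0 < Num.min d (Num.min d1 T) by rewrite !lt_min d0 d10.
have K : {ae leb, forall t, (0 < t -> t < d1 ->
     (`|\int[leb]_(a in `]0%R, 1%R[) (`|v t a - u0|)%:E - 0%:E| < e%:E)%E) /\
    {ae leb, forall a, 0 < t -> t <= T -> 0 < a -> a < 1 -> v t a = v' (t, a)}}.
  by apply: ae_mono2 H vv' => t ? ?; split.
have [s /andP[s0]] := ae_exists_small K d20.
rewrite !lt_min => /and3P[sd sd1 sT] [/(_ s0 sd1) Hs vs].
have vsx x : {ae leb, forall a, 0 < a -> a < 1 -> `|v s a - x| = `|v' (s, a) - x|}.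
  by apply: ae_mono vs => a H1 a0 a1; rewrite (H1 s0 (ltW sT) a0 a1).
have ms x : measurable_fun `]0 : R, 1[ (fun a => `|v' (s, a) - x|).
  by apply: measurable_funTS; exact: measurable_process_dist.
move: Hs; rewrite sube0 gee0_abs; last by apply: integral_ge0 => a _; rewrite lee_fin.
move=> Hs.
have iu0 : unit_integrable (fun a => `|v s a - u0|).
  exists (fun a => `|v' (s, a) - u0|); last exact: vsx.
  apply/integrableP; split; first by apply/measurable_EFinP; exact: ms.
  apply: le_lt_trans (lt_trans Hs (ltry e)); apply: le_integral_ae.
  apply: ae_mono (vsx u0) => a H1 /=; rewrite in_itv/= => /andP[a0 a1].
  by rewrite lee_fin normr_id H1.
exists s; first by rewrite s0.
split=> //; split; first by rewrite -lee_fin EFin_unit_mean// ltW.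
move=> x; apply: (unit_integrable_le (ms x) (vsx x)
  (unit_integrableD iu0 (unit_integrable_cst `|u0 - x|))).
apply: ae_mono (vsx u0) => a H1 a0 a1; rewrite normr_id H1//.
exact: ler_distD.
Qed.

Lemma process_dist_integrable t x : 0 < t -> t <= T -> op_domain A x ->
  unit_integrable (fun a => `|v t a - x|).
Proof.
move=> t0 tT [z Axz]; have [_ ineq _] := ips.
have [s /andP[s0 st] [_ [_ is_]]] := process_small_times ltr01 t0.
have [/bochner_unit_integrable ib _] := ineq x z Axz s t s0 (ltW st) tT.
have := unit_integrableD ib (is_ x); rewrite (_ : (fun a => _) = (fun a => `|v t a - x|))//.
by apply/funext => a; rewrite subrK.
Qed.

(** Bounding the bracket by a difference quotient before exchanging the order of
    integration leaves an integrable function. *)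
Lemma process_step_le x x' c l s t B : 0 < l -> A (x, c - l^-1 *: (x - x')) ->
  op_domain A x' -> 0 < s -> s <= t -> t <= T ->
  (forall r, s < r <= t -> dist_mean r x' - dist_mean r x <= B) ->
  dist_mean t x - dist_mean s x <=
    ioc_int (fun r => `|g r - c|) s t + (t - s) / l * B.
Proof.
move=> l0 Ax Dx' s0 st tT HB.
have Dx : op_domain A x by eexists; exact: Ax.
have [mv ineq _] := ips.
have [v' [sv' vv' vv'2]] := process_representative mv.
have ix r y : s <= r -> r <= t -> op_domain A y -> unit_integrable (fun a => `|v r a - y|).
  by move=> sr rt Dy; apply: process_dist_integrable => //; lra.
have [_] := ineq _ _ Ax s t s0 st tT.
have -> : (\int[leb]_(a in `]0%R, 1%R[) (`|v t a - x| - `|v s a - x|)%:E =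
    (dist_mean t x - dist_mean s x)%:E)%E.
  have it := ix t x st (lexx t) Dx; have is_ := ix s x (lexx s) st Dx.
  have := unit_integrableD it (unit_integrableZ (-1) is_).
  rewrite (_ : (fun a => _ + _) = (fun a => `|v t a - x| - `|v s a - x|)); last first.
    by apply/funext => a; rewrite mulN1r.
  move=> itsx; rewrite -EFin_unit_mean//; congr EFin.
  rewrite -[RHS](_ : unit_mean (fun a => `|v t a - x| + -1 * `|v s a - x|) = _).
    by congr unit_mean; apply/funext => a; rewrite mulN1r.
  by rewrite unit_meanD ?unit_meanZ// ?mulN1r//; exact: unit_integrableZ.
pose Theta (p : RR) : R := `|g p.1 - c| + (`|v' p - x'| - `|v' p - x|) / l.
pose D1 : set (measurableTypeR R) := `]s, t]%classic.
pose D2 : set (measurableTypeR R) := `]0, 1[%classic.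
pose ThetaD : RR -> \bar R := fun p => if (p.1 \in D1) && (p.2 \in D2) then (Theta p)%:E else 0%E.
have mD1 : measurable D1 by exact: measurable_itv.
have mD2 : measurable D2 by exact: measurable_itv.
have mTheta : measurable_fun [set: RR] Theta.
  apply: measurable_funD.
    apply: (@measurableT_comp _ _ _ _ _ _ (fun r : measurableTypeR R => `|g r - c|)).
      by apply: (forcing_measurable_dist fg) => r; exact: cvg_cst.
    exact: measurable_fst.
  apply: measurable_funM => //; apply: measurable_funB.
    exact: (measurable_fun_limit_simple (F := fun y => `|y - x'|) sv' (@continuous_dist _ _ x')).
  exact: (measurable_fun_limit_simple (F := fun y => `|y - x|) sv' (@continuous_dist _ _ x)).
have mThetaD : measurable_fun [set: RR] ThetaD.
  have -> : ThetaD = (EFin \o Theta) \_ (D1 `*` D2).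
    apply/funext => p; rewrite /ThetaD /patch /=.
    have -> // : (p \in D1 `*` D2) = (p.1 \in D1) && (p.2 \in D2).
    by apply/idP/andP; rewrite !inE => -[? ?]; split; rewrite ?inE.
  apply/(measurable_restrictT _ (measurableX mD1 mD2)).
  by apply/measurable_EFinP; exact: measurable_funTS.
have ThetaD1 a : a \in D2 -> (fun r => ThetaD (r, a)) = (fun r => (Theta (r, a))%:E) \_ D1.
  by move=> aD; apply/funext => r; rewrite /ThetaD /patch/= aD andbT.
have ThetaD2 r : r \in D1 -> (fun a => ThetaD (r, a)) = (fun a => (Theta (r, a))%:E) \_ D2.
  by move=> rD; apply/funext => a; rewrite /ThetaD /patch/= rD.
pose K r := `|g r - c| + `|x - x'| / l.
have iK : ioc_integrable s t K.
  by apply: ioc_integrableD; [exact: forcing_dist_integrable|exact: ioc_integrable_cst].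
have ThetaK p : `|Theta p| <= K p.1.
  rewrite /Theta /K; apply: le_trans (ler_normD _ _) _; rewrite normr_id lerD2l.
  rewrite normrM (gtr0_norm (_ : 0 < l^-1)) ?invr_gt0// ler_pM2r ?invr_gt0//.
  apply: le_trans (ler_dist_dist _ _) _.
  by rewrite opprB addrC addrA subrK.
(* Integrability is uniform in [alpha]: the process enters [Theta] only through
   a difference of distances, bounded by [`|x - x'|]. *)
have iThetaD : (leb \x leb)%E.-integrable [set: RR] ThetaD.
  apply/(integrable12ltyP leb leb mThetaD).
  have /integrableP[_] := iK; rewrite integral_mkcond.
  apply: le_lt_trans; apply: le_integral_ae; apply: aeW => r _.
  rewrite /patch; case: ifPn => rD; last first.
    rewrite integral0_eq// => a _; rewrite /ThetaD/= (negbTE rD)/=.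
    by rewrite normr0.
  apply: (@le_trans _ _ (\int[leb]_(a in D2) (`|K r|)%:E)%E).
    rewrite [leRHS]integral_mkcond; apply: le_integral_ae; apply: aeW => a _.
    rewrite /ThetaD/= rD /patch /=; case: (a \in D2) => /=; last by rewrite normr0.
    by rewrite lee_fin; apply: le_trans (ThetaK (r, a)) (ler_norm _).
  by rewrite integral_cst//= lebesgue_measure_unit mule1.
rewrite -lee_fin => Hle; apply: le_trans Hle _.
apply: (@le_trans _ _ (\int[leb]_a \int[leb]_r ThetaD (r, a))%E).
  rewrite [leLHS]integral_mkcond; apply: le_integral_ae.
  apply: ae_mono vv'2 => a va _; rewrite /patch; case: ifPn => aD; last first.
    rewrite integral0_eq// => r _; rewrite /ThetaD/=.
    by move: aD; rewrite -/D2 => /negbTE ->; rewrite andbF.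
  rewrite (ThetaD1 a aD) -integral_mkcond; apply: le_integral_ae.
  apply: ae_mono2 va fgE => r vr fr; rewrite /= in_itv/= => /andP[sr rt].
  have r0 : 0 < r by lra.
  have rT : r <= T by lra.
  move: aD; rewrite inE /D2 /= in_itv/= => /andP[a0 a1].
  rewrite lee_fin vr// fr// /Theta /=.
  have -> : g r - (c - l^-1 *: (x - x')) =
     (g r - c) + l^-1 *: ((v' (r, a) - x') - (v' (r, a) - x)).
    by lincomb R [:: g r; c; x; x'; v' (r, a)]; ring.
  exact: bracket_le_norm.
rewrite -(Fubini iThetaD).
have -> : (t - s) / l * B = (t - s) * (B / l) by ring.
have ig := forcing_dist_integrable c s t fg.
have icB := ioc_integrable_cst s t (B / l).
rewrite -ioc_int_cst// -ioc_intD// EFin_ioc_int; last exact: ioc_integrableD.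
rewrite [leRHS]integral_mkcond; apply: le_integral_ae.
apply: ae_mono vv' => r vr _; rewrite [leRHS]/patch; case: ifPn => rD; last first.
  rewrite integral0_eq// => a _; rewrite /ThetaD/=.
  by move: rD; rewrite -/D1 => /negbTE ->.
rewrite (ThetaD2 r rD) -integral_mkcond.
move: rD; rewrite inE /D1 /= in_itv/= => /andP[sr rt].
have r0 : 0 < r by lra.
have rT : r <= T by lra.
have irx := ix r x (ltW sr) rt Dx; have irx' := ix r x' (ltW sr) rt Dx'.
pose h a := `|g r - c| + l^-1 * (`|v r a - x'| + -1 * `|v r a - x|).
have ihd : unit_integrable (fun a => `|v r a - x'| + -1 * `|v r a - x|).
  by apply: unit_integrableD => //; exact: unit_integrableZ.
have ih : unit_integrable h.
  by apply: unit_integrableD; [exact: unit_integrable_cst|exact: unit_integrableZ].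
have -> : (\int[leb]_(a in D2) (Theta (r, a))%:E = (unit_mean h)%:E)%E.
  rewrite EFin_unit_mean//; apply: integral_ae_eq; apply: ae_mono vr => a va.
  rewrite /D2 /= in_itv/= => /andP[a0 a1]; rewrite /h /Theta va//=.
  by congr EFin; rewrite mulN1r [_ / l]mulrC.
rewrite lee_fin /h unit_meanD; [|exact: unit_integrable_cst|exact: unit_integrableZ].
rewrite unit_mean_cst lerD2l unit_meanZ// unit_meanD//; last exact: unit_integrableZ.
rewrite unit_meanZ// mulN1r [B / l]mulrC ler_pM2l ?invr_gt0//.
by apply: HB; rewrite sr.
Qed.

Lemma process_profile : distance_profile A g u0 T
  (fun t x => if t == 0 then `|u0 - x| else dist_mean t x).
Proof.
split=> [x _|x x' c l l0 Ax Dx' s t B /andP[s0 st] tT HB]; first by rewrite eqxx.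
have Dx : op_domain A x by eexists; exact: Ax.
have HB' s1 r : s <= s1 -> s1 < r <= t -> dist_mean r x' - dist_mean r x <= B.
  move=> ss1 /andP[sr rt]; have := HB r; rewrite rt andbT (le_lt_trans ss1 sr).
  by rewrite gt_eqF//; [move=> /(_ isT)|lra].
move: s0; rewrite le_eqVlt => /predU1P[s0|s0]; last first.
  rewrite !gt_eqF//; last lra.
  apply: (process_step_le l0 Ax Dx') => // r; exact: HB'.
rewrite -s0 eqxx in st HB' *; move: st; rewrite le_eqVlt => /predU1P[<-|t0].
  by rewrite eqxx !subrr ioc_int_id add0r !mul0r.
rewrite gt_eqF// subr0; apply/ler_addgt0Pr => e e0.
have B1 : 0 < `|B| / l + 1 by rewrite ltr_wpDl// divr_ge0// ltW.
pose d := Num.min t (e / 2 / (`|B| / l + 1)).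
have d0 : 0 < d by rewrite lt_min t0 divr_gt0// divr_gt0.
have e2 : 0 < e / 2 by lra.
have [r /andP[r0 rd] [iu0 [ru0 irx]]] := process_small_times e2 d0.
move: rd; rewrite lt_min => /andP[rt]; rewrite ltr_pdivlMr// => re.
have := process_step_le l0 Ax Dx' r0 (ltW rt) tT (HB' r ^~ (ltW r0)).
have : dist_mean r x <= dist_mean r u0 + `|u0 - x|.
  rewrite -[X in _ + X]unit_mean_cst -unit_meanD//; last exact: unit_integrable_cst.
  apply: le_unit_mean => //.
    by apply: unit_integrableD => //; exact: unit_integrable_cst.
  by apply: aeW => a _ _; exact: ler_distD.
have : ioc_int (fun r => `|g r - c|) r t <= ioc_int (fun r => `|g r - c|) 0 t.
  rewrite (ioc_int_split (ltW r0) (ltW rt) (forcing_dist_integrable c 0 t fg)).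
  by rewrite lerDr ioc_int_ge0.
have : (t - r) / l * B <= t / l * B + r * (`|B| / l).
  have -> : (t - r) / l * B = t / l * B - r * (B / l) by ring.
  rewrite lerD2l -mulrN ler_pM2l// -mulNr ler_pM2r ?invr_gt0//.
  by rewrite lerNl; have := ler_norm (- B); rewrite normrN; lra.
rewrite mulrDr mulr1 in re; move: ru0; lra.
Qed.

(** The distance to [p] is measurable in [alpha], up to a null set, as the limit
    of the distances to nearby points of the domain; its mean is then zero. *)
Lemma process_concentrates t p : 0 < t -> t <= T ->
  (forall e, 0 < e -> exists x, [/\ op_domain A x, `|p - x| <= e & dist_mean t x <= e]) ->
  {ae leb, forall a, 0 < a -> a < 1 -> v t a = p}.
Proof.
move=> t0 tT Hp.
have ek k : 0 < k.+1%:R^-1 :> R by rewrite invr_gt0.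
have /choice[x xP] : forall k : nat, exists x, [/\ op_domain A x,
    `|p - x| <= k.+1%:R^-1 & dist_mean t x <= k.+1%:R^-1].
  by move=> k; exact: Hp.
have ix k : unit_integrable (fun a => `|v t a - x k|).
  by have [Dx _ _] := xP k; exact: process_dist_integrable.
have /choice[h hP] : forall k, exists h : R -> R,
    leb.-integrable `]0, 1[ (EFin \o h) /\
    {ae leb, forall a, 0 < a -> a < 1 -> `|v t a - x k| = h a}.
  by move=> k; have [h ? ?] := ix k; exists h.
have [N [mN N0 subN]] : {ae leb, forall a, forall k, 0 < a -> a < 1 -> `|v t a - x k| = h k a}.
  by apply: ae_foralln => k; exact: (hP k).2.
pose D : set (measurableTypeR R) := `]0, 1[%classic `\` N.
have mD : measurable D by apply: measurableD => //; exact: measurable_itv.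
have hD k a : D a -> h k a = `|v t a - x k|.
  move=> [/=]; rewrite in_itv/= => /andP[a0 a1] Na.
  by apply: contrapT => hne; apply: Na; apply: subN => /= H; apply: hne; rewrite H.
have xp : x k @[k --> \oo] --> p.
  apply/cvgrPdist_le => e e0; near=> k.
  have [_ px _] := xP k; apply: le_trans px _; apply: ltW.
  by near: k; exact: (near_infty_natSinv_lt (PosNum e0)).
have mdist : measurable_fun D (fun a => `|v t a - p|).
  apply: (@measurable_fun_cvg _ _ _ _ h).
    move=> k; have /integrableP[/measurable_EFinP mh _] := (hP k).1.
    by apply: measurable_funS mh => //; exact: subDsetl.
  move=> a Da; have -> : h ^~ a = fun k => `|v t a - x k|.
    by apply/funext => k; exact: hD.
  by apply: cvg_norm; apply: cvgB; [exact: cvg_cst|exact: xp].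
have I0 : (\int[leb]_(a in D) (`|v t a - p|)%:E = 0)%E.
  apply/eqP; rewrite eq_le integral_ge0 ?andbT; last by move=> a _; rewrite lee_fin.
  apply/lee_addgt0Pr => e e0; rewrite add0e.
  have e2 : 0 < e / 2 by lra.
  have [k _ /(_ k (leqnn k))/ltW/= ke] := near_infty_natSinv_lt (PosNum e2).
  have [Dx px dx] := xP k.
  have ixp := unit_integrableD (ix k) (unit_integrable_cst `|x k - p|).
  apply: (@le_trans _ _ (unit_mean (fun a => `|v t a - x k| + `|x k - p|))%:E).
    rewrite EFin_unit_mean// integral_mkcond [leRHS]integral_mkcond.
    apply: le_integral_ae; apply: aeW => a _; rewrite /patch.
    case: ifPn => [|_]; last by case: ifP => // _; rewrite lee_fin addr_ge0.
    move=> /set_mem [aD _]; rewrite mem_set// lee_fin; exact: ler_distD.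
  rewrite lee_fin unit_meanD//; last exact: unit_integrable_cst.
  rewrite unit_mean_cst [`|x k - p|]distrC.
  apply: le_trans (lerD dx px) _; move: (k.+1%:R^-1) ke => z; lra.
have mdistE : measurable_fun D (fun a => (`|v t a - p|)%:E) by exact/measurable_EFinP.
have := (ae_eq_integral_abs leb mD mdistE).1.
have -> : (\int[leb]_(a in D) `|(`|v t a - p|)%:E| = \int[leb]_(a in D) (`|v t a - p|)%:E)%E.
  by apply: eq_integral => a _; rewrite gee0_abs// lee_fin.
move=> /(_ I0) ae0; have aeN : {ae leb, forall a, ~ N a}.
  by exists N; split => // a /= /contrapT.
apply: ae_mono2 ae0 aeN => a H Na a0 a1.
have Da : D a by split => //=; rewrite in_itv/= a0.
have /(_ Da) := H; move=> -[] /eqP; rewrite normr_eq0 subr_eq0 => /eqP //.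
Unshelve. all: by end_near. Qed.

End ProcessProfile.

(** * The equivalence *)

Section CoincidingProcess.
Context {R : realType} {X : completeNormedModType R}.
Variable A : set (X * X).
Context (f g : R -> X) (u0 : X) (T : R) (v : R -> R -> X) (w : R -> X).
Local Notation leb := (@lebesgue_measure R).
Local Notation RR := (measurableTypeR R * measurableTypeR R)%type.
Hypothesis T0 : 0 < T.
Hypothesis fg : forcing g.
Hypothesis fgE : {ae leb, forall t, 0 < t -> t <= T -> f t = g t}.
Hypothesis mv : process_measurable T v.
Hypothesis vw : process_coincides T v w.

(** The null set of [alpha] in [process_coincides] depends on the time; by
    Tonelli's theorem the two quantifiers can be exchanged almost everywhere. *)
Lemma process_coincides_swap : {within `[0, T], continuous w} ->
  {ae leb, forall a, {ae leb, forall t, 0 < t -> t <= T -> 0 < a -> a < 1 ->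
     v t a = w t}}.
Proof.
move=> cw; have [v' [sv' vv1 vv2]] := process_representative mv.
pose D : set RR := `]0, T]%classic `*` `]0, 1[%classic.
have mD : measurable D by exact: measurableX.
have mdist : measurable_fun D (fun p : RR => `|v' p - w p.1|).
  apply: (@measurable_fun_caratheodory _ _ _ _ _ _ (fun p y => `|y - w p.1|) mD sv').
    move=> y; have mw := within_measurable_dist cw y.
    have -> : (fun p : RR => `|y - w p.1|) = (fun t => `|w t - y|) \o fst.
      by apply/funext => p; rewrite /= distrC.
    apply: (measurable_comp (F := `]0, T]%classic)) mw _ => //.
    - by move=> _ [[t a] [tT _] <-].
    - exact: measurable_funTS measurable_fst.
  by move=> p _; exact: continuous_dist.
pose E : set RR := D `&` [set p | `|v' p - w p.1| != 0].
have mE : measurable E.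
  have := mdist mD (~` [set 0]) (measurableC (measurable_set1 _)).
  congr measurable; apply/seteqP; split=> p [Dp /= pE]; split => //=.
    exact/eqP.
  by move/eqP: pE.
have E1 : {ae leb, forall t, {ae leb, forall a, ~ E (t, a)}}.
  apply: ae_mono vv1 => t vt.
  have [/andP[t0 tT]|tT] := boolP (0 < t <= T); last first.
    apply: aeW => a [[+ _] _]; rewrite /= in_itv/= => H; by rewrite H in tT.
  apply: ae_mono2 vt (vw t0 tT) => a va wa [[_ /=]]; rewrite in_itv/= => /andP[a0 a1].
  by rewrite -va// wa// subrr normr0 eqxx.
have := ae_swap mE E1; apply: ae_mono2 vv2 => a va.
apply: ae_mono2 va => t vt Et t0 tT a0 a1; rewrite vt//.
apply: contrapT => vne; apply: Et; split.
  by split; rewrite /= in_itv/= ?t0 ?a0.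
by rewrite /= normr_eq0 subr_eq0; apply/eqP.
Qed.

Lemma coinciding_integral_process_solution : integral_solution A T f u0 w ->
  integral_process_solution A T f u0 v.
Proof.
move=> [cw w0 iw]; split => //.
  move=> x z Axz s t s0 st tT.
  have tE : {ae leb, forall a, 0 < a -> a < 1 ->
      `|v t a - x| - `|v s a - x| = `|w t - x| - `|w s - x|}.
    apply: ae_mono2 (vw (lt_le_trans s0 st) tT) (vw s0 (le_trans st tT)).
    by move=> a vt vs a0 a1; rewrite vt// vs.
  have cst_int (c : R) : (\int[leb]_(a in `]0%R, 1%R[) c%:E = c%:E)%E.
    by rewrite integral_cst//= lebesgue_measure_unit mule1.
  split.
    split.
      exists (fun _ _ => `|w t - x| - `|w s - x|); split.
        move=> _; split.
          apply: (sub_finite_set _ (finite_set1 (`|w t - x| - `|w s - x|))).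
          by move=> _ [a _ <-].
        move=> y; have [<-|ne] := pselect (`|w t - x| - `|w s - x| = y).
          rewrite (_ : _ @^-1` _ = setT); first exact: measurableT.
          by apply/seteqP; split.
        rewrite (_ : _ @^-1` _ = set0); first exact: measurable0.
        by apply/seteqP; split.
      apply: ae_mono tE => a H; rewrite /= in_itv/= => /andP[a0 a1].
      by rewrite H//; exact: cvg_cst.
    have -> : (\int[leb]_(a in `]0%R, 1%R[) (`| (`|v t a - x| - `|v s a - x| : R^o) |)%:E =
        \int[leb]_(a in `]0%R, 1%R[) (`| (`|w t - x| - `|w s - x|) |)%:E)%E.
      apply: integral_ae_eq; apply: ae_mono tE => a H; rewrite /= in_itv/= => /andP[a0 a1].
      by rewrite H.
    by rewrite cst_int ltry.
  have -> : (\int[leb]_(a in `]0%R, 1%R[) (`|v t a - x| - `|v s a - x|)%:E =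
        \int[leb]_(a in `]0%R, 1%R[) (`|w t - x| - `|w s - x|)%:E)%E.
    apply: integral_ae_eq; apply: ae_mono tE => a H; rewrite /= in_itv/= => /andP[a0 a1].
    by rewrite H.
  have := iw x z Axz s t (ltW s0) st tT.
  rewrite (integral_bracketE fg fgE cw x z (ltW s0) tT) => Hw.
  rewrite cst_int; apply: le_trans Hw _; rewrite -cst_int.
  rewrite le_eqVlt; apply/orP; left; apply/eqP; apply: integral_ae_eq.
  apply: ae_mono (process_coincides_swap cw) => a va; rewrite /= in_itv/= => /andP[a0 a1].
  rewrite -(integral_bracketE fg fgE cw x z (ltW s0) tT); apply: integral_ae_eq.
  apply: ae_mono va => r vr; rewrite /= in_itv/= => /andP[sr rt].
  by rewrite vr//; lra.
move=> e e0; have e2 : 0 < e / 2 by lra.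
have T0' : (0 : R) <= 0 <= T by rewrite lexx ltW.
have [d d0 H] := (within_continuous_itvP w 0 T).1 cw 0 T0' _ e2.
exists (Num.min d T); first by rewrite lt_min d0.
apply: aeW => t t0; rewrite lt_min => /andP[td tT].
have -> : (\int[leb]_(a in `]0%R, 1%R[) (`|v t a - u0|)%:E =
    \int[leb]_(a in `]0%R, 1%R[) (`|w t - u0|)%:E)%E.
  apply: integral_ae_eq; apply: ae_mono (vw t0 (ltW tT)) => a va.
  by rewrite /= in_itv/= => /andP[a0 a1]; rewrite va.
rewrite integral_cst//= lebesgue_measure_unit mule1 sube0 /= lte_fin normr_id.
have tT' : 0 <= t <= T by apply/andP; split; lra.
have := H t tT'; rewrite subr0 gtr0_norm// => /(_ (ltW td)); rewrite w0; lra.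
Qed.

End CoincidingProcess.

Theorem theorem7p4 (R : realType) (X : completeNormedModType R)
    (A : set (X * X)) (u0 : X) (T : R) (g : R -> X) (u : R -> R -> X)
    (hA : m_accretive A)
    (hu0 : closure (op_domain A) u0)
    (hT : 0 < T)
    (hg : bochner_L1 (@lebesgue_measure R) `]0, T[ g)
    (hu : process_measurable T u) :
  integral_process_solution A T g u0 u <->
  independent_of_alpha T u /\
  exists2 w : R -> X,
    unique_integral_mild_solution A T g u0 w & process_coincides T u w.
Proof.
have [g' fg' gg'] := bochner_forcing hg.
split=> [ips|[_ [w [_ iw _] uw]]]; last first.
  exact: coinciding_integral_process_solution fg' gg' hu uw iw.
have [w sw] := unique_integral_mild_solution_exists hA fg' hu0 gg' hT.
have uw : process_coincides T u w.
  move=> t t0 tT; have [p Hp] := profile_endpoint hA t0 fg' hu0.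
  have [_ iw _] := sw.
  have Pw := distance_profile_restrict tT (integral_solution_profile fg' gg' iw).
  have Pu := distance_profile_restrict tT (process_profile hT fg' gg' ips).
  apply: (process_concentrates hT ips t0 tT) => e e0.
  have e2 : 0 < e / 2 by lra.
  have [x [Dx px prof]] := Hp _ e2; exists x; split => //.
    by have := prof _ Pw => /=; lra.
  by have := prof _ Pu; rewrite gt_eqF//; lra.
by split; [exists w|exists w].
Qed.
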